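(* Suppose $A,B$ are $\Sigma^0_2$ sets and $(A,B)$ is an Ahmad pair. Then $B$ is $\mathrm{high}_2$.
   Context: All sets are subsets of $\omega$. $A\le_e B$ (enumeration reducibility) means there is a c.e. set $\Gamma$ with $A=\Gamma(B):=\{x:\exists\text{ finite }D\subseteq B,\ \langle x,D\rangle\in\Gamma\}$; $<_e$ as usual. Let $(\Gamma_e)_e$ list all c.e. sets; $K_X=\bigoplus_e\Gamma_e(X)$, and the enumeration jump is $X'=K_X\oplus(\omega\setminus K_X)$, with iterates $X'',X'''$; $0'_e=\emptyset'$, $0'''_e=\emptyset'''$. $\Sigma^0_2$ sets are those $\le_e 0'_e$. $X$ is $\mathrm{high}_2$ if $X''\ge_e 0'''_e$. $(A,B)$ is an Ahmad pair if $A\not\le_e B$ and every $\Sigma^0_2$ set $Z<_e A$ satisfies $Z\le_e B$. *)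

(* Defs.v *)
From Stdlib Require Export Arith Ensembles.
From Stdlib Require Import Lia Cantor.

Notation "⟨ x , y ⟩" := (Cantor.to_nat (x, y)) (at level 0, x, y at level 99).

(** Partial recursive functions, presented as unary functions on [nat]; tuples
    are passed through the Cantor pairing. *)
Inductive code : Type :=
| Zero | Succ | Fst | Snd
| Pair (f g : code)
| Comp (f g : code)
| Prec (f g : code)
| Mu (f : code).

(** h(a,0) = F(a) and h(a,n+1) = G(a,n,h(a,n)), on graphs. *)
Fixpoint prec_graph (F G : nat -> nat -> Prop) (a n y : nat) : Prop :=
  match n with
  | 0 => F a y
  | S m => exists z, prec_graph F G a m z /\ G ⟨a, ⟨m, z⟩⟩ y
  end.

(** [eval c x y]: the computation of [c] on [x] converges with value [y]. *)
Fixpoint eval (c : code) (x y : nat) : Prop :=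
  match c with
  | Zero => y = 0
  | Succ => y = S x
  | Fst => y = fst (Cantor.of_nat x)
  | Snd => y = snd (Cantor.of_nat x)
  | Pair f g => exists u v, eval f x u /\ eval g x v /\ y = ⟨u, v⟩
  | Comp f g => exists u, eval g x u /\ eval f u y
  | Prec f g =>
      prec_graph (eval f) (eval g)
        (fst (Cantor.of_nat x)) (snd (Cantor.of_nat x)) y
  | Mu f =>
      eval f ⟨x, y⟩ 0 /\ forall k, k < y -> exists v, eval f ⟨x, k⟩ (S v)
  end.

Definition dom (c : code) : Ensemble nat := fun x => exists y, eval c x y.

Definition ce (W : Ensemble nat) : Prop :=
  exists c, forall x, W x <-> dom c x.

Fixpoint encode (c : code) : nat :=
  match c with
  | Zero => 0
  | Succ => 1
  | Fst => 2
  | Snd => 3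
  | Pair f g => 4 * ⟨encode f, encode g⟩ + 4
  | Comp f g => 4 * ⟨encode f, encode g⟩ + 5
  | Prec f g => 4 * ⟨encode f, encode g⟩ + 6
  | Mu f => 4 * encode f + 7
  end.

(** The e-th c.e. set. As [encode] is a bijection (see below), [gamma e] is the
    domain of the unique program with code [e]. *)
Definition gamma (e : nat) : Ensemble nat :=
  fun x => exists c, encode c = e /\ dom c x.

Lemma encode_inj (c d : code) : encode c = encode d -> c = d.
Proof.
  revert d; induction c; intros d H; destruct d; cbn [encode] in H; try lia;
    try reflexivity;
    try (assert (E : ⟨encode c1, encode c2⟩ = ⟨encode d1, encode d2⟩) by lia;
         apply Cantor.to_nat_inj in E; injection E as E1 E2; f_equal; auto).
  f_equal; apply IHc; lia.
Qed.

Lemma encode_surj (e : nat) : exists c, encode c = e.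
Proof.
  induction e as [e IH] using lt_wf_ind.
  destruct (le_lt_dec 4 e) as [H|H].
  - pose proof (Nat.div_mod_eq (e - 4) 4) as E.
    pose proof (Nat.mod_upper_bound (e - 4) 4 ltac:(lia)) as Hr.
    set (q := (e - 4) / 4) in *; set (r := (e - 4) mod 4) in *.
    destruct (Cantor.of_nat q) as [a b] eqn:Eq.
    assert (Hq : ⟨a, b⟩ = q) by (rewrite <- Eq; apply Cantor.cancel_to_of).
    pose proof (Cantor.to_nat_non_decreasing a b) as Hab.
    destruct (IH a ltac:(lia)) as [f Hf], (IH b ltac:(lia)) as [g Hg],
      (IH q ltac:(lia)) as [h Hh].
    assert (r = 0 \/ r = 1 \/ r = 2 \/ r = 3) as [R|[R|[R|R]]] by lia;
      [exists (Pair f g)|exists (Comp f g)|exists (Prec f g)|exists (Mu h)];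
      cbn [encode]; rewrite ?Hf, ?Hg, ?Hh; lia.
  - destruct e as [|[|[|[|e]]]]; [exists Zero|exists Succ|exists Fst|exists Snd|];
      simpl; lia.
Qed.

Lemma ce_iff_gamma (W : Ensemble nat) :
  ce W <-> exists e, forall x, W x <-> gamma e x.
Proof.
  split.
  - intros [c H]; exists (encode c); intro x; rewrite H; unfold gamma; split.
    + intro Hx; exists c; auto.
    + intros (d & E & Hx); apply encode_inj in E; subst; exact Hx.
  - intros [e H]; destruct (encode_surj e) as [c Hc]; exists c; intro x.
    rewrite H; unfold gamma; split.
    + intros (d & E & Hx); rewrite <- Hc in E; apply encode_inj in E; subst; exact Hx.
    + intro Hx; exists c; auto.
Qed.

(** Canonical indexing of finite sets: D_u is the set of positions of the 1s in
    the binary expansion of [u]. *)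
Definition fin_set (u : nat) : Ensemble nat := fun i => Nat.testbit u i = true.

Definition enum_op (G B : Ensemble nat) : Ensemble nat :=
  fun x => exists u, Included nat (fin_set u) B /\ G ⟨x, u⟩.

Definition e_le (A B : Ensemble nat) : Prop :=
  exists G, ce G /\ forall x, A x <-> enum_op G B x.

Definition e_lt (A B : Ensemble nat) : Prop := e_le A B /\ ~ e_le B A.

Definition join (A B : Ensemble nat) : Ensemble nat :=
  fun n => exists x, (n = 2 * x /\ A x) \/ (n = 2 * x + 1 /\ B x).

Definition big_join (F : nat -> Ensemble nat) : Ensemble nat :=
  fun n => exists e x, n = ⟨e, x⟩ /\ F e x.

Definition K (X : Ensemble nat) : Ensemble nat :=
  big_join (fun e => enum_op (gamma e) X).

Definition jump (X : Ensemble nat) : Ensemble nat :=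
  join (K X) (Complement nat (K X)).

Definition zero_jump : Ensemble nat := jump (Empty_set nat).
Definition zero_jump3 : Ensemble nat := jump (jump (jump (Empty_set nat))).

Definition Sigma02 (A : Ensemble nat) : Prop := e_le A zero_jump.

Definition high2 (X : Ensemble nat) : Prop := e_le zero_jump3 (jump (jump X)).

Definition Ahmad_pair (A B : Ensemble nat) : Prop :=
  ~ e_le A B /\ forall Z, Sigma02 Z -> e_lt Z A -> e_le Z B.

(* Main.v *)
Require Import Defs.
From Stdlib Require Import Lia Cantor Classical.

(** Write C for K_B; then B is high_2 iff C is high over 0', so it is enough to
    define "T_n is infinite", for a uniformly Pi-1 sequence (T_n) that is
    complete for Pi-3, by a Sigma-2 formula over C.  Since (A, B) is an Ahmad
    pair, no Z <=_e A satisfies both A not<=_e Z and Z not<=_e B.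

    A is computable from C.  Choose a sparse Pi-1 set T, fill the columns of Z
    outside T, and code only A up to the predecessor of h in the column h of T.
    If A <=_e Z then initial segments of A determine longer ones over 0', so A
    is Delta-2.  Otherwise Z <=_e B, and C reads A off from Z.

    C is high over 0'.  From h, C computes a bound beyond which (i) coding A in
    columns attached to h has refuted Z = Gamma_i(B) for i <= h, and (ii) coding
    nothing has refuted A = Gamma_j(Z) for j <= h.  Call h in T_n good if the
    next element of T_n exceeds this bound.  If infinitely many h are good,
    alternate between (i) and (ii) along the good elements: the number of
    earlier good elements is read off from C below h, which is guessed by the
    name of the column, wrong guesses being filled or coding only boundedly
    much.  The resulting Z is impossible.  So good elements are bounded, and T_n
    is infinite iff from some element of T_n on the C-computable bound always
    reaches the next one. *)

(** * Recursive functions and decidable predicates *)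

Definition p1 (x : nat) : nat := fst (Cantor.of_nat x).
Definition p2 (x : nat) : nat := snd (Cantor.of_nat x).

#[global] Opaque Cantor.to_nat Cantor.of_nat.

Lemma p1_pair (a b : nat) : p1 ⟨a, b⟩ = a.
Proof. unfold p1; rewrite Cantor.cancel_of_to; reflexivity. Qed.

Lemma p2_pair (a b : nat) : p2 ⟨a, b⟩ = b.
Proof. unfold p2; rewrite Cantor.cancel_of_to; reflexivity. Qed.

Lemma pair_eta (x : nat) : ⟨p1 x, p2 x⟩ = x.
Proof.
  unfold p1, p2; rewrite <- surjective_pairing; apply Cantor.cancel_to_of.
Qed.

Ltac psimp := cbn beta in *; repeat rewrite ?p1_pair, ?p2_pair in *.

Lemma pair_mono (a b c d : nat) : a <= c -> b <= d -> ⟨a, b⟩ <= ⟨c, d⟩.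
Proof.
  intros H1 H2; pose proof (Cantor.to_nat_spec a b);
    pose proof (Cantor.to_nat_spec c d); nia.
Qed.

Lemma le_pair_l (a b : nat) : a <= ⟨a, b⟩.
Proof. pose proof (Cantor.to_nat_non_decreasing a b); lia. Qed.

Lemma le_pair_r (a b : nat) : b <= ⟨a, b⟩.
Proof. pose proof (Cantor.to_nat_non_decreasing a b); lia. Qed.

Lemma p1_le (x : nat) : p1 x <= x.
Proof. rewrite <- (pair_eta x) at 2; apply le_pair_l. Qed.

Lemma p2_le (x : nat) : p2 x <= x.
Proof. rewrite <- (pair_eta x) at 2; apply le_pair_r. Qed.

Lemma eval_det (c : code) (x y z : nat) : eval c x y -> eval c x z -> y = z.
Proof.
  revert x y z; induction c; cbn [eval]; intros x y z; try congruence.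
  - intros (u & v & H1 & H2 & ->) (u' & v' & H1' & H2' & ->).
    rewrite (IHc1 _ _ _ H1 H1'), (IHc2 _ _ _ H2 H2'); reflexivity.
  - intros (u & H1 & H2) (u' & H1' & H2').
    rewrite (IHc2 _ _ _ H1 H1') in H2; eauto.
  - generalize (fst (Cantor.of_nat x)) (snd (Cantor.of_nat x)); intros a n.
    revert y z; induction n as [|n IHn]; cbn [prec_graph]; intros y z.
    + apply IHc1.
    + intros (u & H1 & H2) (u' & H1' & H2').
      rewrite (IHn _ _ H1 H1') in H2; eauto.
  - intros [H1 H2] [H1' H2'].
    destruct (lt_eq_lt_dec y z) as [[L|E]|L]; [|exact E|].
    + destruct (H2' _ L) as [v Hv]; specialize (IHc _ _ _ H1 Hv); discriminate.
    + destruct (H2 _ L) as [v Hv]; specialize (IHc _ _ _ H1' Hv); discriminate.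
Qed.

Definition rec_fun (f : nat -> nat) : Prop :=
  exists c, forall x, eval c x (f x).

(** Zero codes truth: conjunction becomes a sum, disjunction a product, a bounded universal
    quantifier a finite sum, and [Mu] can search for a witness directly. *)
Definition rec_pred (P : nat -> Prop) : Prop :=
  exists f, rec_fun f /\ forall x, P x <-> f x = 0.

Lemma rec_fun_ext (f g : nat -> nat) :
  rec_fun f -> (forall x, f x = g x) -> rec_fun g.
Proof. intros [c H] E; exists c; intro x; rewrite <- E; apply H. Qed.

Lemma rec_comp (f g : nat -> nat) :
  rec_fun f -> rec_fun g -> rec_fun (fun x => f (g x)).
Proof. intros [c H] [d I]; exists (Comp c d); intro x; exists (g x); auto. Qed.

Lemma rec_S (f : nat -> nat) : rec_fun f -> rec_fun (fun x => S (f x)).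
Proof. apply (rec_comp S); exists Succ; reflexivity. Qed.

Lemma rec_p1 (f : nat -> nat) : rec_fun f -> rec_fun (fun x => p1 (f x)).
Proof. apply (rec_comp p1); exists Fst; reflexivity. Qed.

Lemma rec_p2 (f : nat -> nat) : rec_fun f -> rec_fun (fun x => p2 (f x)).
Proof. apply (rec_comp p2); exists Snd; reflexivity. Qed.

Lemma rec_pair (f g : nat -> nat) :
  rec_fun f -> rec_fun g -> rec_fun (fun x => ⟨f x, g x⟩).
Proof.
  intros [c H] [d I]; exists (Pair c d); intro x; exists (f x), (g x); auto.
Qed.

Lemma rec_id : rec_fun (fun x => x).
Proof.
  apply rec_fun_ext with (fun x => ⟨p1 x, p2 x⟩); [|exact pair_eta].
  exists (Pair Fst Snd); intro x; exists (p1 x), (p2 x); repeat split.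
Qed.

Lemma rec_const (n : nat) : rec_fun (fun _ => n).
Proof.
  induction n as [|n IH]; [exists Zero; reflexivity|apply rec_S, IH].
Qed.

Fixpoint prec (f g : nat -> nat) (a n : nat) : nat :=
  match n with
  | 0 => f a
  | S m => g ⟨a, ⟨m, prec f g a m⟩⟩
  end.

Lemma rec_prec (f g a b : nat -> nat) :
  rec_fun f -> rec_fun g -> rec_fun a -> rec_fun b ->
  rec_fun (fun x => prec f g (a x) (b x)).
Proof.
  intros [c H] [d I] Ha Hb.
  apply rec_fun_ext with (fun x => prec f g (p1 ⟨a x, b x⟩) (p2 ⟨a x, b x⟩));
    [|intro; psimp; reflexivity].
  apply (rec_comp (fun p => prec f g (p1 p) (p2 p))); [|apply rec_pair; auto].
  exists (Prec c d); intro x; cbn [eval]; fold (p1 x) (p2 x).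
  induction (p2 x) as [|n IH]; cbn [prec prec_graph]; [apply H|].
  exists (prec f g (p1 x) n); auto.
Qed.

Lemma rec_pred_nat (f : nat -> nat) : rec_fun f -> rec_fun (fun x => pred (f x)).
Proof.
  intro H; apply (rec_comp pred); [|exact H].
  apply rec_fun_ext
    with (fun x => prec (fun _ => 0) (fun p => p1 (p2 p)) 0 x).
  - apply rec_prec; auto using rec_const, rec_id, rec_p1, rec_p2.
  - intros [|x]; cbn [prec]; psimp; reflexivity.
Qed.

Lemma rec_add (f g : nat -> nat) :
  rec_fun f -> rec_fun g -> rec_fun (fun x => f x + g x).
Proof.
  intros Hf Hg.
  apply rec_fun_ext
    with (fun x => prec (fun a => a) (fun p => S (p2 (p2 p))) (f x) (g x)).
  - apply rec_prec; auto using rec_id, rec_S, rec_p2.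
  - intro x; induction (g x) as [|n IH]; cbn [prec]; psimp; lia.
Qed.

Lemma rec_sub (f g : nat -> nat) :
  rec_fun f -> rec_fun g -> rec_fun (fun x => f x - g x).
Proof.
  intros Hf Hg.
  apply rec_fun_ext
    with (fun x => prec (fun a => a) (fun p => pred (p2 (p2 p))) (f x) (g x)).
  - apply rec_prec; auto using rec_id, rec_pred_nat, rec_p2.
  - intro x; induction (g x) as [|n IH]; cbn [prec]; psimp; lia.
Qed.

Lemma rec_mul (f g : nat -> nat) :
  rec_fun f -> rec_fun g -> rec_fun (fun x => f x * g x).
Proof.
  intros Hf Hg.
  apply rec_fun_ext
    with (fun x => prec (fun _ => 0) (fun p => p1 p + p2 (p2 p)) (f x) (g x)).
  - apply rec_prec; auto using rec_const, rec_add, rec_id, rec_p1, rec_p2.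
  - intro x; induction (g x) as [|n IH]; cbn [prec]; psimp; lia.
Qed.

Lemma rec_pow2 (f : nat -> nat) : rec_fun f -> rec_fun (fun x => 2 ^ f x).
Proof.
  intros Hf.
  apply rec_fun_ext
    with (fun x => prec (fun _ => 1) (fun p => 2 * p2 (p2 p)) 0 (f x)).
  - apply rec_prec; auto using rec_const, rec_mul, rec_id, rec_p2.
  - intro x; induction (f x) as [|n IH]; cbn [prec]; psimp; [reflexivity|].
    rewrite IH, Nat.pow_succ_r'; reflexivity.
Qed.

Fixpoint sum_below (n : nat) (f : nat -> nat) : nat :=
  match n with 0 => 0 | S m => sum_below m f + f m end.

Lemma rec_sum (b : nat -> nat) (f : nat -> nat -> nat) :
  rec_fun b -> rec_fun (fun p => f (p1 p) (p2 p)) ->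
  rec_fun (fun x => sum_below (b x) (f x)).
Proof.
  intros Hb Hf.
  apply rec_fun_ext with (fun x => prec (fun _ => 0)
    (fun p => p2 (p2 p) + f (p1 ⟨p1 p, p1 (p2 p)⟩) (p2 ⟨p1 p, p1 (p2 p)⟩)) x (b x)).
  - apply rec_prec; auto using rec_const, rec_id.
    apply rec_add; [auto using rec_id, rec_p1, rec_p2|].
    apply (rec_comp (fun p => f (p1 p) (p2 p))); auto.
    auto using rec_pair, rec_id, rec_p1, rec_p2.
  - intro x; induction (b x) as [|n IH]; cbn [prec sum_below]; psimp; lia.
Qed.

Ltac recf :=
  cbn beta;
  lazymatch goal with
  | |- rec_fun (fun x => x) => apply rec_id
  | |- rec_fun p1 => exact (rec_p1 _ rec_id)
  | |- rec_fun p2 => exact (rec_p2 _ rec_id)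
  | |- rec_fun (fun _ => ?c) => apply (rec_const c)
  | |- rec_fun (fun x => S (@?f x)) => apply (rec_S f); recf
  | |- rec_fun (fun x => pred (@?f x)) => apply (rec_pred_nat f); recf
  | |- rec_fun (fun x => p1 (@?f x)) => apply (rec_p1 f); recf
  | |- rec_fun (fun x => p2 (@?f x)) => apply (rec_p2 f); recf
  | |- rec_fun (fun x => Cantor.to_nat (@?f x, @?g x)) => apply (rec_pair f g); recf
  | |- rec_fun (fun x => @?f x + @?g x) => apply (rec_add f g); recf
  | |- rec_fun (fun x => @?f x * @?g x) => apply (rec_mul f g); recf
  | |- rec_fun (fun x => @?f x - @?g x) => apply (rec_sub f g); recf
  | |- rec_fun (fun x => 2 ^ @?f x) => apply (rec_pow2 f); recf
  | |- rec_fun (fun x => sum_below (@?b x) (@?f x)) => apply (rec_sum b f); recf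
  | H : rec_fun ?f |- rec_fun ?f => exact H
  | H : rec_fun ?f |- rec_fun (fun x => ?f (@?g x)) => apply (rec_comp f g H); recf
  end.

Lemma rec_pred_ext (P Q : nat -> Prop) :
  rec_pred P -> (forall x, P x <-> Q x) -> rec_pred Q.
Proof.
  intros (f & Hf & H) E; exists f; split; [exact Hf|].
  intro x; rewrite <- E; apply H.
Qed.

Lemma dec_sub (P : nat -> Prop) (f : nat -> nat) :
  rec_pred P -> rec_fun f -> rec_pred (fun x => P (f x)).
Proof. intros (g & Hg & H) Hf; exists (fun x => g (f x)); split; [recf|auto]. Qed.

Lemma dec_sub2 (P : nat -> nat -> Prop) (f g : nat -> nat) :
  rec_pred (fun p => P (p1 p) (p2 p)) -> rec_fun f -> rec_fun g ->
  rec_pred (fun x => P (f x) (g x)).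
Proof.
  intros HP Hf Hg.
  apply rec_pred_ext with (fun x => P (p1 ⟨f x, g x⟩) (p2 ⟨f x, g x⟩));
    [|intro; psimp; reflexivity].
  apply (dec_sub (fun p => P (p1 p) (p2 p))); [exact HP|recf].
Qed.

Lemma dec_le (f g : nat -> nat) :
  rec_fun f -> rec_fun g -> rec_pred (fun x => f x <= g x).
Proof. intros; exists (fun x => f x - g x); split; [recf|intro; lia]. Qed.

Lemma dec_eq (f g : nat -> nat) :
  rec_fun f -> rec_fun g -> rec_pred (fun x => f x = g x).
Proof.
  intros; exists (fun x => (f x - g x) + (g x - f x)); split; [recf|intro; lia].
Qed.

Lemma dec_and (P Q : nat -> Prop) :
  rec_pred P -> rec_pred Q -> rec_pred (fun x => P x /\ Q x).
Proof.
  intros (f & Hf & H) (g & Hg & I); exists (fun x => f x + g x); split; [recf|].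
  intro x; rewrite H, I; lia.
Qed.

Lemma dec_or (P Q : nat -> Prop) :
  rec_pred P -> rec_pred Q -> rec_pred (fun x => P x \/ Q x).
Proof.
  intros (f & Hf & H) (g & Hg & I); exists (fun x => f x * g x); split; [recf|].
  intro x; rewrite H, I, Nat.eq_mul_0; reflexivity.
Qed.

Lemma dec_not (P : nat -> Prop) : rec_pred P -> rec_pred (fun x => ~ P x).
Proof.
  intros (f & Hf & H); exists (fun x => 1 - f x); split; [recf|].
  intro x; rewrite H; lia.
Qed.

Lemma dec_imp (P Q : nat -> Prop) :
  rec_pred P -> rec_pred Q -> rec_pred (fun x => P x -> Q x).
Proof.
  intros HP HQ; apply rec_pred_ext with (fun x => ~ P x \/ Q x).
  - apply dec_or; auto using dec_not.
  - intro x; tauto.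
Qed.

Lemma sum_below_zero (n : nat) (f : nat -> nat) :
  sum_below n f = 0 <-> forall i, i < n -> f i = 0.
Proof.
  induction n as [|n IH]; cbn [sum_below]; [split; [lia|auto]|].
  split.
  - intros H i Hi; destruct (Nat.eq_dec i n) as [->|]; [lia|].
    apply IH; lia.
  - intro H; rewrite (H n) by lia; rewrite (proj2 IH); auto.
Qed.

Lemma dec_ball (b : nat -> nat) (P : nat -> nat -> Prop) :
  rec_fun b -> rec_pred (fun p => P (p1 p) (p2 p)) ->
  rec_pred (fun x => forall y, y < b x -> P x y).
Proof.
  intros Hb (f & Hf & H).
  exists (fun x => sum_below (b x) (fun y => f ⟨x, y⟩)); split; [recf|].
  intro x; rewrite sum_below_zero; split; intros I y Hy.
  - apply H; psimp; auto.
  - specialize (I y Hy); apply H in I; psimp; exact I.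
Qed.

Lemma dec_bex (b : nat -> nat) (P : nat -> nat -> Prop) :
  rec_fun b -> rec_pred (fun p => P (p1 p) (p2 p)) ->
  rec_pred (fun x => exists y, y < b x /\ P x y).
Proof.
  intros Hb H.
  apply rec_pred_ext with (fun x => ~ forall y, y < b x -> ~ P x y).
  - apply dec_not, dec_ball; [exact Hb|apply dec_not, H].
  - intro x; split.
    + intro N; apply NNPP; intro M; apply N; intros y Hy HP; eauto.
    + intros (y & Hy & HP) N; exact (N y Hy HP).
Qed.

(** * Canonical finite sets *)

Lemma fin_set_lt (u i : nat) : fin_set u i -> i < u.
Proof.
  unfold fin_set; intro H.
  assert (~ Nat.log2 u < i) by (intro L; apply Nat.bits_above_log2 in L; congruence).
  destruct u as [|u]; [rewrite Nat.bits_0 in H; discriminate|].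
  pose proof (Nat.log2_lt_lin (S u) ltac:(lia)); lia.
Qed.

(** Splitting [u] into low bits, the bit at [i] and high bits leaves bounded quantifiers over
    arithmetic, which makes membership decidable. *)
Lemma fin_set_arith (u i : nat) :
  fin_set u i <->
  exists a, a < S u /\ exists b, b < 2 ^ i /\ u = b + (1 + 2 * a) * 2 ^ i.
Proof.
  unfold fin_set; split.
  - intro H; destruct (Nat.testbit_spec u i) as (l & h & Hl & E).
    rewrite H in E; cbn [Nat.b2n] in E; exists h; split; [|exists l; lia].
    assert (2 ^ i <> 0) by (apply Nat.pow_nonzero; lia); nia.
  - intros (a & _ & b & Hb & E).
    apply (Nat.testbit_unique u i true b a); auto.
Qed.

Lemma dec_bit (f g : nat -> nat) :
  rec_fun f -> rec_fun g -> rec_pred (fun x => fin_set (f x) (g x)).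
Proof.
  intros Hf Hg; apply dec_sub2 with (P := fin_set); auto.
  eapply rec_pred_ext; [|intro x; symmetry; apply fin_set_arith].
  apply dec_bex; [recf|]; apply dec_bex; [recf|].
  cbn beta; apply dec_eq; recf.
Qed.

Ltac decs :=
  cbn beta;
  lazymatch goal with
  | |- rec_pred (fun x => @?P x /\ @?Q x) => apply (dec_and P Q); decs
  | |- rec_pred (fun x => @?P x \/ @?Q x) => apply (dec_or P Q); decs
  | |- rec_pred (fun x => ~ @?P x) => apply (dec_not P); decs
  | |- rec_pred (fun x => @?f x = @?g x) => apply (dec_eq f g); recf
  | |- rec_pred (fun x => @?f x < @?g x) =>
      apply (dec_le (fun x => S (f x)) g); recf
  | |- rec_pred (fun x => @?f x <= @?g x) => apply (dec_le f g); recf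
  | |- rec_pred (fun x => fin_set (@?f x) (@?g x)) => apply (dec_bit f g); recf
  | |- rec_pred (fun x => exists y, y < @?b x /\ @?P x y) =>
      apply (dec_bex b P); [recf|decs]
  | |- rec_pred (fun x => forall y, y < @?b x -> @?P x y) =>
      apply (dec_ball b P); [recf|decs]
  | |- rec_pred (fun x => @?P x -> @?Q x) => apply (dec_imp P Q); decs
  | H : rec_pred ?P |- rec_pred ?P => exact H
  | H : rec_pred ?P |- rec_pred (fun x => ?P (@?f x)) => apply (dec_sub P f H); recf
  | H : rec_pred (fun p => ?P (p1 p) (p2 p)) |- rec_pred (fun x => ?P (@?f x) (@?g x)) =>
      apply (dec_sub2 P f g H); recf
  end.

Lemma fin_set_sub_iff (u : nat) (X : Ensemble nat) :
  Included nat (fin_set u) X <-> forall i, i < u -> ~ fin_set u i \/ X i.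
Proof.
  split.
  - intros H i _; destruct (classic (fin_set u i)); [right; apply H; auto|auto].
  - intros H i Hi; destruct (H i (fin_set_lt _ _ Hi)); [contradiction|auto].
Qed.

Lemma fin_set_0 (i : nat) : ~ fin_set 0 i.
Proof. unfold fin_set; rewrite Nat.bits_0; discriminate. Qed.

Lemma fin_set_lor (u v i : nat) :
  fin_set (Nat.lor u v) i <-> fin_set u i \/ fin_set v i.
Proof.
  unfold fin_set; rewrite Nat.lor_spec; apply Bool.orb_true_iff.
Qed.

Lemma fin_set_pow2 (a i : nat) : fin_set (2 ^ a) i <-> i = a.
Proof.
  unfold fin_set; rewrite Nat.pow2_bits_eqb, Nat.eqb_eq; split; auto.
Qed.

Lemma fin_set_ext (u v : nat) : (forall i, fin_set u i <-> fin_set v i) -> u = v.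
Proof.
  intro H; apply Nat.bits_inj; intro i; apply Bool.eq_true_iff_eq, H.
Qed.

Lemma fin_set_le (u v : nat) : Included nat (fin_set u) (fin_set v) -> u <= v.
Proof.
  intro H; replace u with (Nat.land u v); [apply Nat.land_le_r|].
  apply fin_set_ext; intro i; unfold fin_set.
  rewrite Nat.land_spec, Bool.andb_true_iff; split; [tauto|].
  intro I; split; [exact I|apply H, I].
Qed.

Lemma fin_set_lt_pow2 (u n : nat) : (forall i, fin_set u i -> i < n) -> u < 2 ^ n.
Proof.
  intro H; replace u with (u mod 2 ^ n).
  - apply Nat.mod_upper_bound, Nat.pow_nonzero; lia.
  - apply fin_set_ext; intro i; unfold fin_set.
    destruct (le_lt_dec n i) as [L|L].
    + rewrite Nat.mod_pow2_bits_high by exact L; split; [discriminate|].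
      intro I; apply H in I; lia.
    + rewrite Nat.mod_pow2_bits_low by exact L; reflexivity.
Qed.

Lemma fin_set_comprehension (P : nat -> Prop) (n : nat) :
  exists u, forall i, fin_set u i <-> i < n /\ P i.
Proof.
  induction n as [|n [u IH]].
  - exists 0; intro i; split; [intro H; destruct (fin_set_0 _ H)|lia].
  - destruct (classic (P n)) as [H|H].
    + exists (Nat.lor u (2 ^ n)); intro i.
      rewrite fin_set_lor, IH, fin_set_pow2; split.
      * intros [[L I]| ->]; split; auto; lia.
      * intros [L I]; destruct (Nat.eq_dec i n); [auto|left; split; [lia|auto]].
    + exists u; intro i; rewrite IH; split; intros [L I]; split; auto; try lia.
      destruct (Nat.eq_dec i n); [subst; contradiction|lia].
Qed.

(** * The normal form of c.e. sets *)

(* A finite set [u] of items ⟨c, ⟨x, y⟩⟩, read as "the program coded by [c] maps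
   [x] to [y]", is a certificate when every item follows from others in one
   computation step. *)
Definition justified (u c x y : nat) : Prop :=
  c = 0 /\ y = 0 \/ c = 1 /\ y = S x \/ c = 2 /\ y = p1 x \/ c = 3 /\ y = p2 x \/
  (exists q, q < c /\
    (c = 4 * q + 4 /\ fin_set u ⟨p1 q, ⟨x, p1 y⟩⟩ /\ fin_set u ⟨p2 q, ⟨x, p2 y⟩⟩ \/
     c = 4 * q + 5 /\ (exists z, z < u /\
       (fin_set u ⟨p2 q, ⟨x, z⟩⟩ /\ fin_set u ⟨p1 q, ⟨z, y⟩⟩)) \/
     c = 4 * q + 6 /\
       (p2 x = 0 /\ fin_set u ⟨p1 q, ⟨p1 x, y⟩⟩ \/
        0 < p2 x /\ (exists z, z < u /\
          (fin_set u ⟨c, ⟨⟨p1 x, pred (p2 x)⟩, z⟩⟩ /\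
           fin_set u ⟨p2 q, ⟨⟨p1 x, ⟨pred (p2 x), z⟩⟩, y⟩⟩))) \/
     c = 4 * q + 7 /\ fin_set u ⟨q, ⟨⟨x, y⟩, 0⟩⟩ /\
       (forall k, k < y -> exists v, v < u /\ fin_set u ⟨q, ⟨⟨x, k⟩, S v⟩⟩))).

Definition certificate (u : nat) : Prop :=
  forall i, i < u -> fin_set u i -> justified u (p1 i) (p1 (p2 i)) (p2 (p2 i)).

Lemma dec_certificate (f : nat -> nat) :
  rec_fun f -> rec_pred (fun x => certificate (f x)).
Proof.
  intro H; apply (dec_sub certificate); [|exact H].
  unfold certificate, justified; decs.
Qed.

(** Components never exceed a pair and elements stay below the code of their set, which is why the
    bounds [z < u] and [v < u] in [justified] exclude nothing. *)
Lemma item_lt (u c x y : nat) : fin_set u ⟨c, ⟨x, y⟩⟩ -> x < u /\ y < u.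
Proof.
  intro H; apply fin_set_lt in H.
  pose proof (le_pair_r c ⟨x, y⟩); pose proof (le_pair_l x y);
    pose proof (le_pair_r x y); lia.
Qed.

Lemma certificate_item (u c x y : nat) :
  certificate u -> fin_set u ⟨c, ⟨x, y⟩⟩ -> justified u c x y.
Proof.
  intros H I; specialize (H _ (fin_set_lt _ _ I) I); psimp; exact H.
Qed.

Ltac cert_inv H :=
  cbn [encode] in H; unfold justified in H;
  destruct H as [H|[H|[H|[H|(q & _ & [H|[H|[H|H]]])]]]]; try lia.

(** The items carry no order, yet circular support is impossible: an item rests on items with a
    smaller program or, for [Prec], also on the same program with a smaller recursion argument. *)
Lemma certificate_sound (d : code) (u x y : nat) :
  certificate u -> fin_set u ⟨encode d, ⟨x, y⟩⟩ -> eval d x y.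
Proof.
  intro C; revert x y; induction d; intros x y I;
    pose proof (certificate_item _ _ _ _ C I) as J; cbn [eval].
  - cert_inv J; apply J.
  - cert_inv J; apply J.
  - cert_inv J; apply J.
  - cert_inv J; apply J.
  - cert_inv J; destruct J as (E & J1 & J2).
    assert (q = ⟨encode d1, encode d2⟩) as -> by lia; psimp.
    exists (p1 y), (p2 y); rewrite pair_eta; auto.
  - cert_inv J; destruct J as (E & z & _ & J1 & J2).
    assert (q = ⟨encode d1, encode d2⟩) as -> by lia; psimp.
    exists z; auto.
  - clear J; fold (p1 x) (p2 x); rewrite <- (pair_eta x) in I.
    revert I; generalize (p1 x) (p2 x); intros a n; revert y.
    induction n as [|n IHn]; intros y I;
      pose proof (certificate_item _ _ _ _ C I) as J; cert_inv J;
      destruct J as (E & J);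
      assert (q = ⟨encode d1, encode d2⟩) as -> by lia; psimp;
      cbn [prec_graph].
    + destruct J as [[_ J]|[J _]]; [auto|lia].
    + destruct J as [[J _]|(_ & z & _ & J1 & J2)]; [lia|].
      cbn [pred] in *; exists z; split; [apply IHn; exact J1|auto].
  - cert_inv J; destruct J as (E & J1 & J2).
    assert (q = encode d) as -> by lia.
    split; [auto|]; intros k Hk; destruct (J2 k Hk) as (v & _ & J3); eauto.
Qed.

Lemma lor_le_l (u v : nat) : u <= Nat.lor u v.
Proof. apply fin_set_le; intros i Hi; apply fin_set_lor; auto. Qed.

Lemma justified_mono (u v c x y : nat) :
  Included nat (fin_set u) (fin_set v) -> justified u c x y -> justified v c x y.
Proof.
  intros H; pose proof (fin_set_le _ _ H) as L; unfold justified.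
  intros [J|[J|[J|[J|(q & Hq & [J|[J|[J|J]]])]]]]; auto 6;
    do 4 right; exists q; split; auto.
  - left; intuition (apply H; assumption).
  - destruct J as (E & z & Hz & J1 & J2); right; left; split; [auto|].
    exists z; split; [lia|split; apply H; assumption].
  - destruct J as (E & J); do 2 right; left; split; [auto|].
    destruct J as [[J1 J2]|(J1 & z & Hz & J2 & J3)]; [left|right; split; auto].
    + split; [auto|apply H, J2].
    + exists z; split; [lia|split; apply H; assumption].
  - destruct J as (E & J1 & J2); do 3 right; split; [auto|split; [apply H, J1|]].
    intros k Hk; destruct (J2 k Hk) as (w & Hw & J3).
    exists w; split; [lia|apply H, J3].
Qed.

Lemma certificate_lor (u v : nat) :
  certificate u -> certificate v -> certificate (Nat.lor u v).
Proof.
  intros Hu Hv i _ Hi; apply fin_set_lor in Hi; destruct Hi as [Hi|Hi].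
  - apply justified_mono with u; [|apply Hu; auto using fin_set_lt].
    intros j Hj; apply fin_set_lor; auto.
  - apply justified_mono with v; [|apply Hv; auto using fin_set_lt].
    intros j Hj; apply fin_set_lor; auto.
Qed.

Lemma certificate_add (u c x y : nat) :
  certificate u -> justified u c x y ->
  exists v, certificate v /\ fin_set v ⟨c, ⟨x, y⟩⟩.
Proof.
  intros C J; exists (Nat.lor u (2 ^ ⟨c, ⟨x, y⟩⟩)).
  assert (S1 : Included nat (fin_set u) (fin_set (Nat.lor u (2 ^ ⟨c, ⟨x, y⟩⟩))))
    by (intros j Hj; apply fin_set_lor; auto).
  split.
  - intros i _ Hi; apply justified_mono with u; [exact S1|].
    apply fin_set_lor in Hi; rewrite fin_set_pow2 in Hi.
    destruct Hi as [Hi| ->]; [apply C; auto using fin_set_lt|psimp; exact J].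
  - apply fin_set_lor; right; apply fin_set_pow2; reflexivity.
Qed.

(** Certificates are closed under union and under adding a justified item, so those of the
    subcomputations are merged and the final item is added. *)
Lemma certificate_complete (d : code) (x y : nat) :
  eval d x y -> exists u, certificate u /\ fin_set u ⟨encode d, ⟨x, y⟩⟩.
Proof.
  assert (C0 : certificate 0) by (intros i Hi; lia).
  assert (Hq : forall a b, ⟨a, b⟩ < 4 * ⟨a, b⟩ + 4) by (intros; lia).
  revert x y; induction d; cbn [eval encode]; intros x y H.
  - apply (certificate_add 0); [auto|]; unfold justified, p1, p2; auto 8.
  - apply (certificate_add 0); [auto|]; unfold justified, p1, p2; auto 8.
  - apply (certificate_add 0); [auto|]; unfold justified, p1, p2; auto 8.
  - apply (certificate_add 0); [auto|]; unfold justified, p1, p2; auto 8.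
  - destruct H as (a & b & H1 & H2 & ->).
    destruct (IHd1 _ _ H1) as (u & Cu & Iu), (IHd2 _ _ H2) as (v & Cv & Iv).
    apply (certificate_add (Nat.lor u v)); [apply certificate_lor; auto|].
    unfold justified; do 4 right; exists ⟨encode d1, encode d2⟩; split; [lia|].
    left; psimp; rewrite !fin_set_lor; auto.
  - destruct H as (a & H1 & H2).
    destruct (IHd1 _ _ H2) as (u & Cu & Iu), (IHd2 _ _ H1) as (v & Cv & Iv).
    apply (certificate_add (Nat.lor u v)); [apply certificate_lor; auto|].
    unfold justified; do 4 right; exists ⟨encode d1, encode d2⟩; split; [lia|].
    right; left; psimp; split; [auto|]; exists a; rewrite !fin_set_lor.
    pose proof (item_lt _ _ _ _ Iu); pose proof (lor_le_l u v); split; [lia|auto].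
  - fold (p1 x) (p2 x) in H; rewrite <- (pair_eta x).
    revert H; generalize (p1 x) (p2 x); intros a n; revert y.
    induction n as [|n IHn]; cbn [prec_graph]; intros y H.
    + destruct (IHd1 _ _ H) as (u & Cu & Iu).
      apply (certificate_add u); [auto|].
      unfold justified; do 4 right; exists ⟨encode d1, encode d2⟩; split; [lia|].
      do 2 right; left; psimp; auto.
    + destruct H as (z & H1 & H2).
      destruct (IHn _ H1) as (u & Cu & Iu), (IHd2 _ _ H2) as (v & Cv & Iv).
      apply (certificate_add (Nat.lor u v)); [apply certificate_lor; auto|].
      unfold justified; do 4 right; exists ⟨encode d1, encode d2⟩; split; [lia|].
      do 2 right; left; psimp; split; [auto|right; split; [lia|]].
      cbn [pred]; exists z; rewrite !fin_set_lor.
      pose proof (item_lt _ _ _ _ Iu); pose proof (lor_le_l u v); split; [lia|auto].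
  - destruct H as [H1 H2].
    (* One certificate covering all the failed tests [k < y] is accumulated by induction. *)
    assert (HH : forall n, n <= y -> exists u, certificate u /\
      forall k, k < n -> exists v, fin_set u ⟨encode d, ⟨⟨x, k⟩, S v⟩⟩).
    { induction n as [|n IHn]; intro Hn; [exists 0; split; [auto|lia]|].
      destruct IHn as (u & Cu & Iu); [lia|].
      destruct (H2 n ltac:(lia)) as [w Hw].
      destruct (IHd _ _ Hw) as (v & Cv & Iv).
      exists (Nat.lor u v); split; [apply certificate_lor; auto|].
      intros k Hk; destruct (Nat.eq_dec k n) as [->|N].
      - exists w; apply fin_set_lor; auto.
      - destruct (Iu k ltac:(lia)) as [w' Hw']; exists w'; apply fin_set_lor; auto. }
    destruct (HH y (le_n _)) as (u & Cu & Iu), (IHd _ _ H1) as (v & Cv & Iv).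
    apply (certificate_add (Nat.lor u v)); [apply certificate_lor; auto|].
    unfold justified; do 4 right; exists (encode d); split; [lia|].
    do 3 right; split; [auto|]; rewrite fin_set_lor; split; [auto|].
    intros k Hk; destruct (Iu k Hk) as [w Hw]; exists w; rewrite fin_set_lor.
    pose proof (item_lt _ _ _ _ Hw); pose proof (lor_le_l u v); split; [lia|auto].
Qed.

(** Kleene's T predicate; the stage [n] packs a certificate with the output. *)
Definition halts_by (e x n : nat) : Prop :=
  certificate (p1 n) /\ fin_set (p1 n) ⟨e, ⟨x, p2 n⟩⟩.

Lemma gamma_halts (e x : nat) : gamma e x <-> exists n, halts_by e x n.
Proof.
  unfold gamma, dom, halts_by; split.
  - intros (c & <- & y & H); destruct (certificate_complete _ _ _ H) as (u & C & I).
    exists ⟨u, y⟩; psimp; auto.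
  - intros (n & C & I); destruct (encode_surj e) as [c <-].
    exists c; split; [auto|]; exists (p2 n); eapply certificate_sound; eauto.
Qed.

Lemma dec_halts_by (f g h : nat -> nat) :
  rec_fun f -> rec_fun g -> rec_fun h ->
  rec_pred (fun x => halts_by (f x) (g x) (h x)).
Proof.
  intros Hf Hg Hh; unfold halts_by; apply dec_and; [|decs].
  apply (dec_certificate (fun x => p1 (h x))); recf.
Qed.

(** [Mu] stops at a zero only after nonzero values at all smaller arguments, hence the passage to
    the least witness. *)
Lemma ce_of_rec (P : nat -> nat -> Prop) :
  rec_pred (fun p => P (p1 p) (p2 p)) -> ce (fun x => exists n, P x n).
Proof.
  intros (f & (c & Hc) & H); exists (Mu c); intro x; unfold dom; cbn [eval].
  assert (H' : forall n, P x n <-> f ⟨x, n⟩ = 0)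
    by (intro n; specialize (H ⟨x, n⟩); psimp; exact H).
  split.
  - intros [n Hn]; induction n as [n IH] using lt_wf_ind.
    destruct (classic (exists m, m < n /\ P x m)) as [(m & L & Hm)|N]; [eauto|].
    exists n; apply H' in Hn; split; [rewrite <- Hn; apply Hc|].
    intros k Hk; specialize (Hc ⟨x, k⟩).
    destruct (f ⟨x, k⟩) as [|v] eqn:E; [|eauto].
    exfalso; apply N; exists k; split; [auto|apply H', E].
  - intros (y & Hy & _); exists y; apply H'; eapply eval_det; eauto.
Qed.

Lemma ce_normal_form (W : Ensemble nat) :
  ce W -> exists P, rec_pred (fun p => P (p1 p) (p2 p)) /\
                    forall x, W x <-> exists n, P x n.
Proof.
  intro H; apply ce_iff_gamma in H; destruct H as [e H].
  exists (halts_by e); split; [apply dec_halts_by; recf|].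
  intro x; rewrite H; apply gamma_halts.
Qed.

Lemma ce_ext (P Q : Ensemble nat) : ce P -> (forall x, P x <-> Q x) -> ce Q.
Proof. intros [c H] E; exists c; intro x; rewrite <- E; apply H. Qed.

Lemma ce_dec (P : nat -> Prop) : rec_pred P -> ce P.
Proof.
  intro H; apply ce_ext with (fun x => exists n : nat, P x).
  - apply (ce_of_rec (fun x _ => P x)); decs.
  - intro x; split; [intros [_ H']; exact H'|exists 0; auto].
Qed.

Lemma ce_sub (P : Ensemble nat) (f : nat -> nat) :
  ce P -> rec_fun f -> ce (fun x => P (f x)).
Proof.
  intros HP Hf; apply ce_normal_form in HP; destruct HP as (Q & HQ & E).
  apply ce_ext with (fun x => exists n, Q (f x) n).
  - apply (ce_of_rec (fun x n => Q (f x) n)); decs.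
  - intro x; symmetry; apply E.
Qed.

Lemma ce_and (P Q : nat -> Prop) : ce P -> ce Q -> ce (fun x => P x /\ Q x).
Proof.
  intros HP HQ; apply ce_normal_form in HP, HQ.
  destruct HP as (P' & HP & EP), HQ as (Q' & HQ & EQ).
  apply ce_ext with (fun x => exists n, P' x (p1 n) /\ Q' x (p2 n)).
  - apply (ce_of_rec (fun x n => P' x (p1 n) /\ Q' x (p2 n))); decs.
  - intro x; rewrite EP, EQ; split.
    + intros (n & H1 & H2); eauto.
    + intros [[n H1] [m H2]]; exists ⟨n, m⟩; psimp; auto.
Qed.

Lemma ce_or (P Q : nat -> Prop) : ce P -> ce Q -> ce (fun x => P x \/ Q x).
Proof.
  intros HP HQ; apply ce_normal_form in HP, HQ.
  destruct HP as (P' & HP & EP), HQ as (Q' & HQ & EQ).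
  apply ce_ext with (fun x => exists n, P' x n \/ Q' x n).
  - apply (ce_of_rec (fun x n => P' x n \/ Q' x n)); decs.
  - intro x; rewrite EP, EQ; split.
    + intros (n & [H|H]); eauto.
    + intros [[n H]|[n H]]; eauto.
Qed.

Lemma ce_ex (P : nat -> nat -> Prop) :
  ce (fun p => P (p1 p) (p2 p)) -> ce (fun x => exists y, P x y).
Proof.
  intro HP; apply ce_normal_form in HP; destruct HP as (P' & HP & EP).
  apply ce_ext with (fun x => exists n, P' ⟨x, p1 n⟩ (p2 n)).
  - apply (ce_of_rec (fun x n => P' ⟨x, p1 n⟩ (p2 n))); decs.
  - intro x; split.
    + intros (n & H); exists (p1 n).
      specialize (EP ⟨x, p1 n⟩); psimp; apply EP; eauto.
    + intros (y & H); specialize (EP ⟨x, y⟩); psimp; apply EP in H.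
      destruct H as [n H]; exists ⟨y, n⟩; psimp; auto.
Qed.

Lemma ball_collection (P : nat -> nat -> Prop) (b : nat) :
  (forall y, y < b -> exists n, P y n) ->
  exists N, forall y, y < b -> exists n, n < N /\ P y n.
Proof.
  induction b as [|b IH]; intro H; [exists 0; lia|].
  destruct IH as [N HN]; [intros; apply H; lia|].
  destruct (H b ltac:(lia)) as [n Hn]; exists (N + S n); intros y Hy.
  destruct (Nat.eq_dec y b) as [->|]; [exists n; split; [lia|auto]|].
  destruct (HN y ltac:(lia)) as (m & L & Hm); exists m; split; [lia|auto].
Qed.

Lemma ce_ball (b : nat -> nat) (P : nat -> nat -> Prop) :
  rec_fun b -> ce (fun p => P (p1 p) (p2 p)) ->
  ce (fun x => forall y, y < b x -> P x y).
Proof.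
  intros Hb HP; apply ce_normal_form in HP; destruct HP as (P' & HP & EP).
  assert (E : forall x y, P x y <-> exists n, P' ⟨x, y⟩ n)
    by (intros x y; specialize (EP ⟨x, y⟩); psimp; exact EP).
  apply ce_ext with
    (fun x => exists N, forall y, y < b x -> exists n, n < N /\ P' ⟨x, y⟩ n).
  - apply (ce_of_rec (fun x N => forall y, y < b x ->
      exists n, n < N /\ P' ⟨x, y⟩ n)); decs.
  - intro x; split.
    + intros [N H] y Hy; apply E; destruct (H y Hy) as (n & _ & I); eauto.
    + intro H; apply ball_collection; intros y Hy; apply E; auto.
Qed.

Lemma ce_gamma (f g : nat -> nat) :
  rec_fun f -> rec_fun g -> ce (fun x => gamma (f x) (g x)).
Proof.
  intros Hf Hg; apply ce_ext with (fun x => exists n, halts_by (f x) (g x) n).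
  - apply (ce_of_rec (fun x n => halts_by (f x) (g x) n)).
    apply dec_halts_by with (f := fun p => f (p1 p)) (g := fun p => g (p1 p)); recf.
  - intro x; symmetry; apply gamma_halts.
Qed.

Ltac ces :=
  cbn beta;
  first
  [ solve [apply ce_dec; decs]
  | lazymatch goal with
    | |- ce (fun x => @?P x /\ @?Q x) => apply (ce_and P Q); ces
    | |- ce (fun x => @?P x \/ @?Q x) => apply (ce_or P Q); ces
    | |- ce (fun x => exists y, @?P x y) => apply (ce_ex P); ces
    | |- ce (fun x => forall y, y < @?b x -> @?P x y) => apply (ce_ball b P); [recf|ces]
    | |- ce (fun x => gamma (@?f x) (@?g x)) => apply (ce_gamma f g); recf
    | H : ce ?P |- ce ?P => exact H
    | H : ce (fun x => ~ ?P x) |- ce (fun x => ~ ?P (@?f x)) =>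
        apply (ce_sub (fun x => ~ P x) f H); recf
    | H : ce ?P |- ce (fun x => ?P (@?f x)) => apply (ce_sub P f H); recf
    end ].

(** * Closure properties of enumeration reducibility *)

Lemma e_ext (J P Q : Ensemble nat) :
  e_le P J -> (forall x, P x <-> Q x) -> e_le Q J.
Proof. intros (G & HG & H) E; exists G; split; [auto|]; intro x; rewrite <- E; auto. Qed.

Lemma e_ce (J P : Ensemble nat) : ce P -> e_le P J.
Proof.
  intro H; exists (fun n => P (p1 n)); split; [ces|].
  intro x; unfold enum_op; split.
  - intro Hx; exists 0; split; [intros i Hi; destruct (fin_set_0 _ Hi)|psimp; auto].
  - intros (u & _ & Hx); psimp; auto.
Qed.

Lemma e_dec (J : Ensemble nat) (P : nat -> Prop) : rec_pred P -> e_le P J.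
Proof. intro H; apply e_ce, ce_dec, H. Qed.

Lemma e_refl (J : Ensemble nat) : e_le J J.
Proof.
  exists (fun n => fin_set (p2 n) (p1 n)); split; [ces|].
  intro x; unfold enum_op; split.
  - intro Hx; exists (2 ^ x); psimp; split; [|apply fin_set_pow2; auto].
    intros i Hi; apply fin_set_pow2 in Hi; subst; exact Hx.
  - intros (u & Hu & Hx); psimp; apply Hu, Hx.
Qed.

Lemma e_sub (J P : Ensemble nat) (f : nat -> nat) :
  e_le P J -> rec_fun f -> e_le (fun x => P (f x)) J.
Proof.
  intros (G & HG & H) Hf; exists (fun n => G ⟨f (p1 n), p2 n⟩); split; [ces|].
  intro x; rewrite H; unfold enum_op; split; intros (u & Hu & Hx); exists u; psimp; auto.
Qed.

Lemma e_or (J : Ensemble nat) (P Q : nat -> Prop) :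
  e_le P J -> e_le Q J -> e_le (fun x => P x \/ Q x) J.
Proof.
  intros (G & HG & H) (G' & HG' & H').
  exists (fun n => G n \/ G' n); split; [ces|].
  intro x; rewrite H, H'; unfold enum_op; split.
  - intros [(u & Hu & Hx)|(u & Hu & Hx)]; exists u; auto.
  - intros (u & Hu & [Hx|Hx]); [left|right]; exists u; auto.
Qed.

Lemma e_ex (J : Ensemble nat) (P : nat -> nat -> Prop) :
  e_le (fun p => P (p1 p) (p2 p)) J -> e_le (fun x => exists y, P x y) J.
Proof.
  intros (G & HG & H).
  exists (fun n => exists y, G ⟨⟨p1 n, y⟩, p2 n⟩); split; [ces|].
  intro x; unfold enum_op; split.
  - intros (y & Hy); specialize (H ⟨x, y⟩); psimp; apply H in Hy.
    destruct Hy as (u & Hu & Hx); exists u; split; [auto|exists y; psimp; auto].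
  - intros (u & Hu & y & Hx); exists y; specialize (H ⟨x, y⟩); psimp; apply H.
    exists u; auto.
Qed.

(** An axiom for [x] must include, for every [y] below the bound, an axiom for the instance at [y];
    the finitely many uses are merged by union. *)
Lemma e_ball (J : Ensemble nat) (b : nat -> nat) (P : nat -> nat -> Prop) :
  rec_fun b -> e_le (fun p => P (p1 p) (p2 p)) J ->
  e_le (fun x => forall y, y < b x -> P x y) J.
Proof.
  intros Hb (G & HG & H).
  exists (fun n => forall y, y < b (p1 n) -> exists v,
    (forall i, i < v -> ~ fin_set v i \/ fin_set (p2 n) i) /\ G ⟨⟨p1 n, y⟩, v⟩).
  split; [ces|]; intro x; unfold enum_op.
  assert (E : forall y, P x y <->
    exists u, Included nat (fin_set u) J /\ G ⟨⟨x, y⟩, u⟩).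
  { intro y; specialize (H ⟨x, y⟩); psimp; exact H. }
  split.
  - intro Hx.
    assert (HH : forall n, n <= b x -> exists u, Included nat (fin_set u) J /\
      forall y, y < n -> exists v, Included nat (fin_set v) (fin_set u) /\ G ⟨⟨x, y⟩, v⟩).
    { induction n as [|n IH]; intro Hn.
      - exists 0; split; [intros i Hi; destruct (fin_set_0 _ Hi)|lia].
      - destruct IH as (u & Hu & Iu); [lia|].
        destruct (proj1 (E n) (Hx n ltac:(lia))) as (v & Hv & Iv).
        exists (Nat.lor u v); split.
        + intros i Hi; apply fin_set_lor in Hi; destruct Hi; [apply Hu|apply Hv]; auto.
        + intros y Hy; destruct (Nat.eq_dec y n) as [->|N].
          * exists v; split; [intros i Hi; apply fin_set_lor; auto|auto].
          * destruct (Iu y ltac:(lia)) as (w & Hw & Iw); exists w; split; [|auto].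
            intros i Hi; apply fin_set_lor; left; apply Hw, Hi. }
    destruct (HH _ (le_n _)) as (u & Hu & Iu); exists u; split; [auto|].
    psimp; intros y Hy; destruct (Iu y Hy) as (v & Hv & Iv); exists v.
    split; [apply fin_set_sub_iff, Hv|auto].
  - intros (u & Hu & Hx) y Hy; psimp; destruct (Hx y Hy) as (v & Hv & Iv).
    apply E; exists v; split; [|auto].
    apply fin_set_sub_iff in Hv; intros i Hi; apply Hu, Hv, Hi.
Qed.

Lemma e_and (J : Ensemble nat) (P Q : nat -> Prop) :
  e_le P J -> e_le Q J -> e_le (fun x => P x /\ Q x) J.
Proof.
  intros (G & HG & H) (G' & HG' & H').
  exists (fun n => exists u, exists v,
    ((forall i, i < u -> ~ fin_set u i \/ fin_set (p2 n) i) /\ G ⟨p1 n, u⟩) /\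
    ((forall i, i < v -> ~ fin_set v i \/ fin_set (p2 n) i) /\ G' ⟨p1 n, v⟩)).
  split; [ces|]; intro x; rewrite H, H'; unfold enum_op; split.
  - intros [(u & Hu & Iu) (v & Hv & Iv)]; exists (Nat.lor u v); psimp; split.
    + intros i Hi; apply fin_set_lor in Hi; destruct Hi; [apply Hu|apply Hv]; auto.
    + exists u, v; split; (split; [|auto]);
        apply fin_set_sub_iff; intros i Hi; apply fin_set_lor; auto.
  - intros (w & Hw & u & v & (Hu & Iu) & (Hv & Iv)); psimp.
    apply fin_set_sub_iff in Hu, Hv.
    split; [exists u|exists v]; (split; [intros i Hi; auto|auto]).
Qed.

Ltac es :=
  cbn beta;
  first
  [ solve [apply e_dec; decs]
  | lazymatch goal with
    | |- e_le (fun x => @?P x /\ @?Q x) ?J => apply (e_and J P Q); es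
    | |- e_le (fun x => @?P x \/ @?Q x) ?J => apply (e_or J P Q); es
    | |- e_le (fun x => exists y, @?P x y) ?J => apply (e_ex J P); es
    | |- e_le (fun x => forall y, y < @?b x -> @?P x y) ?J =>
        apply (e_ball J b P); [recf|es]
    | |- e_le (fun x => gamma (@?f x) (@?g x)) ?J =>
        apply (e_ce J), (ce_gamma f g); recf
    | H : e_le ?P ?J |- e_le ?P ?J => exact H
    | H : e_le (fun x => ~ ?P x) ?J |- e_le (fun x => ~ ?P (@?f x)) ?J =>
        apply (e_sub J (fun x => ~ P x) f H); recf
    | H : e_le ?P ?J |- e_le (fun x => ?P (@?f x)) ?J => apply (e_sub J P f H); recf
    | H : ce (fun x => ~ ?P x) |- e_le (fun x => ~ ?P (@?f x)) ?J =>
        apply (e_ce J), (ce_sub (fun x => ~ P x) f H); recf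
    | H : ce ?P |- e_le (fun x => ?P (@?f x)) ?J => apply (e_ce J), (ce_sub P f H); recf
    end ].

(** Inclusion of a finite set in the oracle is a bounded universal quantifier, so the closure
    properties compose the two operators. *)
Lemma e_trans (P J J' : Ensemble nat) : e_le P J -> e_le J J' -> e_le P J'.
Proof.
  intros (G & HG & H) HJ.
  apply e_ext with (fun x => exists u,
    (forall i, i < u -> ~ fin_set u i \/ J i) /\ G ⟨x, u⟩); [es|].
  intro x; rewrite H; unfold enum_op; split; intros (u & Hu & Hx); exists u;
    (split; [|auto]); apply fin_set_sub_iff; auto.
Qed.

Definition Gam (j : nat) (X : Ensemble nat) : Ensemble nat := enum_op (gamma j) X.

Lemma e_le_Gam (P J : Ensemble nat) :
  e_le P J <-> exists j, forall x, P x <-> Gam j J x.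
Proof.
  unfold e_le, Gam, enum_op; split.
  - intros (G & HG & H); apply ce_iff_gamma in HG; destruct HG as [j Hj].
    exists j; intro x; rewrite H; split; intros (u & Hu & Hx); exists u;
      (split; [auto|apply Hj; auto]).
  - intros [j H]; exists (gamma j); split; [apply ce_iff_gamma; exists j; reflexivity|exact H].
Qed.

(** * The enumeration jump *)

Lemma K_iff (X : Ensemble nat) (n : nat) : K X n <-> Gam (p1 n) X (p2 n).
Proof.
  unfold K, big_join, Gam; split.
  - intros (e & x & -> & H); psimp; exact H.
  - intro H; exists (p1 n), (p2 n); rewrite pair_eta; auto.
Qed.

Lemma e_K (X : Ensemble nat) : e_le (K X) X.
Proof.
  exists (fun n => gamma (p1 (p1 n)) ⟨p2 (p1 n), p2 n⟩); split; [ces|].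
  intro n; rewrite K_iff; unfold Gam, enum_op; split; intros (u & Hu & Hx); exists u;
    psimp; auto.
Qed.

Lemma jump_even (X : Ensemble nat) (n : nat) : jump X (2 * n) <-> K X n.
Proof.
  unfold jump, join; split.
  - intros (x & [[E H]|[E H]]); [|lia]; replace n with x by lia; exact H.
  - intro H; exists n; auto.
Qed.

Lemma jump_odd (X : Ensemble nat) (n : nat) : jump X (2 * n + 1) <-> ~ K X n.
Proof.
  unfold jump, join; split.
  - intros (x & [[E H]|[E H]]); [lia|]; replace n with x by lia; exact H.
  - intro H; exists n; auto.
Qed.

Lemma e_jump_K (X : Ensemble nat) : e_le (K X) (jump X).
Proof.
  pose proof (e_refl (jump X)).
  apply e_ext with (fun n => jump X (2 * n)); [es|intro; apply jump_even].
Qed.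

Lemma e_jump_notK (X : Ensemble nat) : e_le (fun n => ~ K X n) (jump X).
Proof.
  pose proof (e_refl (jump X)).
  apply e_ext with (fun n => jump X (2 * n + 1)); [es|intro; apply jump_odd].
Qed.

Lemma e_jump_pos (P X : Ensemble nat) : e_le P X -> e_le P (jump X).
Proof.
  intro H; pose proof (e_jump_K X); apply e_le_Gam in H; destruct H as [j H].
  apply e_ext with (fun n => K X ⟨j, n⟩); [es|].
  intro x; rewrite K_iff, H; psimp; reflexivity.
Qed.

(** Some column of [K X] is a copy of [P], so the complement of [P] is read off from the negative
    half of the jump. *)
Lemma e_jump_neg (P X : Ensemble nat) : e_le P X -> e_le (fun n => ~ P n) (jump X).
Proof.
  intro H; pose proof (e_jump_notK X); apply e_le_Gam in H; destruct H as [j H].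
  apply e_ext with (fun n => ~ K X ⟨j, n⟩); [es|].
  intro x; rewrite K_iff, H; psimp; reflexivity.
Qed.

Lemma e_jump_co_ce (P X : Ensemble nat) : ce P -> e_le (fun n => ~ P n) (jump X).
Proof. intro H; apply e_jump_neg, e_ce, H. Qed.

Lemma e_jump_of (P X J : Ensemble nat) :
  e_le (K X) J -> e_le (fun n => ~ K X n) J -> e_le P (jump X) -> e_le P J.
Proof.
  intros H1 H2 H; apply (e_trans _ _ _ H); unfold jump, join, Complement.
  apply e_ext with (fun n => exists x, x < S n /\
    (n = 2 * x /\ K X x \/ n = 2 * x + 1 /\ ~ K X x)); [es|].
  intro n; split.
  - intros (x & _ & Hx); eauto.
  - intros (x & Hx); exists x; split; [lia|exact Hx].
Qed.

Lemma jump_mono (X Y : Ensemble nat) : e_le X Y -> e_le (jump X) (jump Y).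
Proof.
  intro H; assert (HK : e_le (K X) Y) by (apply e_trans with X; auto using e_K).
  apply e_jump_of with X; auto using e_jump_pos, e_jump_neg, e_refl.
Qed.

Lemma zero_jump_le_jump (X : Ensemble nat) : e_le zero_jump (jump X).
Proof.
  apply jump_mono; exists (fun _ => False); split.
  - apply ce_dec, rec_pred_ext with (fun _ => 1 = 0); [decs|intro; lia].
  - intro x; split; [intros []|intros (u & _ & [])].
Qed.

(* Computations relative to the total set [jump Y] read off as finite positive
   and negative information about [K Y]. *)
Definition oracle_ok (Q : nat -> Prop) (w : nat) : Prop :=
  (forall z, z < p1 w -> ~ fin_set (p1 w) z \/ Q z) /\
  (forall z, z < p2 w -> ~ fin_set (p2 w) z \/ ~ Q z).

(** The finite part of [jump Y] used by an axiom splits into even elements, which are positive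
    claims about [K Y], and odd ones, which are negative claims. Both sets join the witness, and the
    matrix becomes decidable. *)
Lemma jump_normal_form (P Y : Ensemble nat) :
  e_le P (jump Y) ->
  exists R, rec_pred (fun p => R (p1 p) (p2 p)) /\
    forall x, P x <-> exists w, R x w /\ oracle_ok (K Y) (p1 w).
Proof.
  intros (G & HG & H); apply ce_normal_form in HG; destruct HG as (N & HN & E).
  exists (fun x w => exists u, u < S w /\ exists n, n < S w /\ (N ⟨x, u⟩ n /\
    forall i, i < u -> ~ fin_set u i \/ exists z, z < S u /\
      (i = 2 * z /\ fin_set (p1 (p1 w)) z \/ i = 2 * z + 1 /\ fin_set (p2 (p1 w)) z))).
  split; [decs|].
  intro x; rewrite H; unfold enum_op, oracle_ok; split.
  - intros (u & Hu & Hx); apply E in Hx; destruct Hx as [n Hn].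
    destruct (fin_set_comprehension (fun z => fin_set u (2 * z)) (S u)) as [a Ha].
    destruct (fin_set_comprehension (fun z => fin_set u (2 * z + 1)) (S u)) as [b Hb].
    (* The second component serves only to make [w] a bound for [u] and [n]. *)
    exists ⟨⟨a, b⟩, ⟨u, n⟩⟩; psimp; split; [|split].
    + pose proof (le_pair_r ⟨a, b⟩ ⟨u, n⟩); pose proof (le_pair_l u n);
        pose proof (le_pair_r u n).
      exists u; split; [lia|]; exists n; split; [lia|]; split; [exact Hn|].
      intros i Hi; destruct (classic (fin_set u i)) as [I|I]; [right|auto].
      destruct (Hu _ I) as (z & [[-> _]|[-> _]]); exists z; (split; [lia|]).
      * left; split; [auto|]; apply Ha; split; [lia|exact I].
      * right; split; [auto|]; apply Hb; split; [lia|exact I].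
    + apply fin_set_sub_iff; intros z Hz; apply Ha in Hz; destruct Hz as [_ Hz].
      apply Hu in Hz; apply jump_even, Hz.
    + apply (fin_set_sub_iff b (fun z => ~ K Y z)); intros z Hz; apply Hb in Hz.
      destruct Hz as [_ Hz]; apply Hu in Hz; apply (proj1 (jump_odd Y z)) in Hz; exact Hz.
  - intros (w & (u & _ & n & _ & Hn & Hi) & Ha & Hb); exists u; split.
    + intros i I; destruct (Hi i (fin_set_lt _ _ I)) as [C|(z & _ & [[-> Hz]|[-> Hz]])];
        [contradiction| |].
      * apply jump_even; destruct (Ha z (fin_set_lt _ _ Hz)); [contradiction|auto].
      * apply jump_odd; destruct (Hb z (fin_set_lt _ _ Hz)); [contradiction|auto].
    + apply E; eauto.
Qed.

(** * Sigma-2 sets *)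

Lemma ce_of_e_le_empty (P : Ensemble nat) : e_le P (Empty_set nat) -> ce P.
Proof.
  intros (G & HG & H); apply ce_ext with (fun x => G ⟨x, 0⟩); [ces|].
  intro x; rewrite H; unfold enum_op; split.
  - intro Hx; exists 0; split; [intros i Hi; destruct (fin_set_0 _ Hi)|auto].
  - intros (u & Hu & Hx); replace 0 with u; [exact Hx|].
    apply fin_set_ext; intro i; split; intro Hi.
    + destruct (Hu _ Hi).
    + destruct (fin_set_0 _ Hi).
Qed.

(** Positive claims about the c.e. set [K (Empty_set nat)] receive a stage [s] inside the
    existential witness; negative claims are tested at every [b]. *)
Lemma Sigma2_normal_form (Y : Ensemble nat) :
  e_le Y zero_jump ->
  exists R, rec_pred (fun p => R (p1 p) (p2 p)) /\
    forall z, Y z <-> exists a, forall b, R ⟨z, a⟩ b.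
Proof.
  intro H; apply jump_normal_form in H; destruct H as (R0 & HR0 & E).
  assert (HK : ce (K (Empty_set nat))) by apply ce_of_e_le_empty, e_K.
  apply ce_normal_form in HK; destruct HK as (N & HN & EN).
  exists (fun q b => let z := p1 q in let w := p1 (p2 q) in let s := p2 (p2 q) in
    R0 z w /\
    (forall i, i < p1 (p1 w) -> ~ fin_set (p1 (p1 w)) i \/
       exists t, t < s /\ N i t) /\
    (forall i, i < p2 (p1 w) -> ~ fin_set (p2 (p1 w)) i \/ ~ N i b)).
  split; [cbv zeta; decs|]; cbv zeta.
  intro z; rewrite E; unfold oracle_ok; split.
  - intros (w & Hw & Ha & Hb).
    destruct (ball_collection (fun i t => ~ fin_set (p1 (p1 w)) i \/ N i t)
      (p1 (p1 w))) as [s Hs].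
    { intros i Hi; destruct (Ha i Hi) as [C|C]; [exists 0; auto|].
      apply EN in C; destruct C as [t Ht]; eauto. }
    exists ⟨w, s⟩; intro b; psimp; split; [auto|split].
    + intros i Hi; destruct (Hs i Hi) as (t & Ht & [C|C]); eauto.
    + intros i Hi; destruct (Hb i Hi) as [C|C]; [auto|right].
      intro I; apply C, EN; eauto.
  - intros (a & Ha); psimp; exists (p1 a); split; [apply (Ha 0)|split].
    + intros i Hi; destruct (proj1 (proj2 (Ha 0)) i Hi) as [C|(t & _ & Ht)]; [auto|].
      right; apply EN; eauto.
    + intros i Hi; destruct (classic (fin_set (p2 (p1 (p1 a))) i)) as [I|I]; [right|auto].
      intro C; apply EN in C; destruct C as [t Ht].
      destruct (proj2 (proj2 (Ha t)) i Hi); contradiction.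
Qed.

Lemma least_witness (P : nat -> Prop) :
  (exists n, P n) -> exists n, P n /\ forall m, m < n -> ~ P m.
Proof.
  intros [n Hn]; induction n as [n IH] using lt_wf_ind.
  destruct (classic (exists m, m < n /\ P m)) as [(m & L & Hm)|N]; [eauto|].
  exists n; split; [auto|]; intros m L Hm; apply N; eauto.
Qed.

(* The witness [v] is ⟨a, s⟩ with [a] least such that [R ⟨z, a⟩] always holds and
   [s] least such that every smaller [a] is refuted before [s]. *)
Lemma unique_witness (R : nat -> nat -> Prop) :
  rec_pred (fun p => R (p1 p) (p2 p)) ->
  exists W, ce W /\
    (forall z v, ~ W ⟨z, v⟩ -> exists a, a <= v /\ forall b, R ⟨z, a⟩ b) /\
    (forall z a, (forall b, R ⟨z, a⟩ b) -> exists v, ~ W ⟨z, v⟩) /\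
    (forall z v v', ~ W ⟨z, v⟩ -> ~ W ⟨z, v'⟩ -> v = v').
Proof.
  intro HR.
  set (ref := fun z a s => forall c, c < a -> exists b, b < s /\ ~ R ⟨z, c⟩ b).
  exists (fun n => (exists b, ~ R ⟨p1 n, p1 (p2 n)⟩ b) \/
    ~ ref (p1 n) (p1 (p2 n)) (p2 (p2 n)) \/
    exists t, t < p2 (p2 n) /\ ref (p1 n) (p1 (p2 n)) t).
  split; [unfold ref; ces|].
  assert (HW : forall z v, ~ ((exists b, ~ R ⟨p1 ⟨z, v⟩, p1 (p2 ⟨z, v⟩)⟩ b) \/
      ~ ref (p1 ⟨z, v⟩) (p1 (p2 ⟨z, v⟩)) (p2 (p2 ⟨z, v⟩)) \/
      exists t, t < p2 (p2 ⟨z, v⟩) /\ ref (p1 ⟨z, v⟩) (p1 (p2 ⟨z, v⟩)) t) <->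
    (forall b, R ⟨z, p1 v⟩ b) /\ ref z (p1 v) (p2 v) /\
    forall t, t < p2 v -> ~ ref z (p1 v) t).
  { intros z v; psimp; split.
    - intro H; split; [|split].
      + intro b; apply NNPP; intro N; apply H; eauto.
      + apply NNPP; intro N; apply H; auto.
      + intros t Ht N; apply H; eauto.
    - intros (H1 & H2 & H3) [[b Hb]|[H|(t & Ht & H)]]; auto.
      exact (H3 t Ht H). }
  split; [|split].
  - intros z v H; apply HW in H; exists (p1 v); split; [apply p1_le|apply H].
  - intros z a0 Ha0.
    destruct (least_witness (fun a => forall b, R ⟨z, a⟩ b)) as (a & Ha & Hmin); [eauto|].
    destruct (least_witness (fun s => ref z a s)) as (s & Hs & Hsmin).
    { apply ball_collection; intros c Hc; apply NNPP; intro N.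
      apply (Hmin c Hc); intro b; apply NNPP; intro M; apply N; eauto. }
    exists ⟨a, s⟩; apply HW; psimp; auto.
  - intros z v v' H H'; apply HW in H, H'.
    destruct H as (H1 & H2 & H3), H' as (H1' & H2' & H3').
    assert (E : p1 v = p1 v').
    { destruct (lt_eq_lt_dec (p1 v) (p1 v')) as [[L|E]|L]; [|exact E|].
      - destruct (H2' _ L) as (b & _ & C); destruct (C (H1 b)).
      - destruct (H2 _ L) as (b & _ & C); destruct (C (H1' b)). }
    rewrite <- (pair_eta v), <- (pair_eta v'), E; f_equal; f_equal.
    rewrite E in *.
    destruct (lt_eq_lt_dec (p2 v) (p2 v')) as [[L|E']|L]; [|exact E'|].
    + destruct (H3' _ L H2).
    + destruct (H3 _ L H2').
Qed.

(** Uniqueness keeps information finite: each member contributes exactly one Pi-1 witness. *)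
Lemma Sigma2_unique_witness (Y : Ensemble nat) :
  e_le Y zero_jump ->
  exists W, ce W /\ (forall z, Y z <-> exists v, ~ W ⟨z, v⟩) /\
    (forall z v v', ~ W ⟨z, v⟩ -> ~ W ⟨z, v'⟩ -> v = v').
Proof.
  intro H; apply Sigma2_normal_form in H; destruct H as (R & HR & E).
  destruct (unique_witness R HR) as (W & HW & H1 & H2 & H3).
  exists W; split; [auto|split; [|auto]]; intro z; rewrite E; split.
  - intros [a Ha]; eauto.
  - intros [v Hv]; destruct (H1 _ _ Hv) as (a & _ & Ha); eauto.
Qed.

(* [Zfin L V] is the largest set that agrees with [V] on the columns in [L]. *)
Definition Zfin (L V : nat) : Ensemble nat :=
  fun n => ~ fin_set L (p2 n) \/ fin_set V n.

(** For [q] = ⟨⟨j, x⟩, ⟨L, V⟩⟩ this is [Gam j (Zfin L V) x]. The oracle is decidable uniformly in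
    [L] and [V], so these facts are c.e. *)
Definition fact (q : nat) : Prop :=
  Gam (p1 (p1 q)) (Zfin (p1 (p2 q)) (p2 (p2 q))) (p2 (p1 q)).

(** The stage contains the code [p1 s] of the finite set used, so it bounds the use as well. *)
Definition fact_by (q s : nat) : Prop :=
  (forall i, i < p1 s -> ~ fin_set (p1 s) i \/ Zfin (p1 (p2 q)) (p2 (p2 q)) i) /\
  halts_by (p1 (p1 q)) ⟨p2 (p1 q), p1 s⟩ (p2 s).

Lemma fact_iff (q : nat) : fact q <-> exists s, fact_by q s.
Proof.
  unfold fact, fact_by, Gam, enum_op; split.
  - intros (u & Hu & Hx); apply gamma_halts in Hx; destruct Hx as [n Hn].
    exists ⟨u, n⟩; psimp; split; [apply fin_set_sub_iff, Hu|exact Hn].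
  - intros (s & H1 & H2); exists (p1 s); split; [apply fin_set_sub_iff, H1|].
    apply gamma_halts; eauto.
Qed.

Lemma dec_fact_by : rec_pred (fun p => fact_by (p1 p) (p2 p)).
Proof.
  unfold fact_by, Zfin; apply dec_and; [decs|].
  apply dec_halts_by with (f := fun p => p1 (p1 (p1 p)))
    (g := fun p => ⟨p2 (p1 (p1 p)), p1 (p2 p)⟩) (h := fun p => p2 (p2 p)); recf.
Qed.

Lemma ce_fact : ce fact.
Proof.
  apply ce_ext with (fun q => exists s, fact_by q s).
  - apply (ce_of_rec fact_by), dec_fact_by.
  - intro q; symmetry; apply fact_iff.
Qed.

(** * A left half of an Ahmad pair is computable from [K B] *)

(** Exceeds every fact with [j] and [x] at most [n] whose sets [L] and [V] consist of numbers up to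
    ⟨n, n⟩. *)
Definition fact_range (n : nat) : nat :=
  S ⟨⟨n, n⟩, ⟨2 ^ S ⟨n, n⟩, 2 ^ S ⟨n, n⟩⟩⟩.

Lemma fact_range_bound (n j x L V : nat) :
  j <= n -> x <= n -> L < 2 ^ S ⟨n, n⟩ -> V < 2 ^ S ⟨n, n⟩ ->
  ⟨⟨j, x⟩, ⟨L, V⟩⟩ < fact_range n.
Proof.
  intros; unfold fact_range; apply le_n_S; repeat apply pair_mono; lia.
Qed.

(** Here [v] is a modulus: every true fact in the range of [g] is verified by stage [v]. Being a
    sufficient stage is Pi-1, so [unique_witness] singles out one modulus. *)
Lemma fact_settling :
  exists W, ce W /\ (forall g, exists v, ~ W ⟨g, v⟩) /\
    (forall g v v', ~ W ⟨g, v⟩ -> ~ W ⟨g, v'⟩ -> v = v') /\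
    (forall g v q, ~ W ⟨g, v⟩ -> q < fact_range g -> fact q ->
       exists s, s <= v /\ fact_by q s).
Proof.
  pose proof dec_fact_by as HF.
  destruct (unique_witness (fun n b => forall q, q < fact_range (p1 n) ->
    fact_by q b -> exists s, s < S (p2 n) /\ fact_by q s)) as (W & HW & H1 & H2 & H3).
  { unfold fact_range; decs. }
  exists W; split; [auto|split; [|split; [auto|]]].
  - intro g.
    destruct (ball_collection (fun q s => fact q -> fact_by q s) (fact_range g))
      as [N HN].
    { intros q _; destruct (classic (fact q)) as [F|F]; [|exists 0; tauto].
      apply fact_iff in F; destruct F as [s Hs]; eauto. }
    apply (H2 g N); intros b q Hq Hb; psimp.
    destruct (HN q Hq) as (s & Hs & I); exists s; split; [lia|].
    apply I, fact_iff; eauto.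
  - intros g v q Hv Hq F; destruct (H1 _ _ Hv) as (a & La & Ha).
    apply fact_iff in F; destruct F as [b Hb].
    specialize (Ha b q); psimp; destruct (Ha Hq Hb) as (s & Ls & Hs).
    exists s; split; [lia|auto].
Qed.

(** The sparse set of the first construction. The successor of [g] exceeds the witness [v] and
    encodes [g], so the path back to 0 is computable and, for c.e. [W], membership is Pi-1. *)
Inductive chain (W : Ensemble nat) : nat -> Prop :=
| chain_0 : chain W 0
| chain_S (g v : nat) : chain W g -> ~ W ⟨g, v⟩ -> chain W (S ⟨v, g⟩).

Definition prd (h : nat) : nat := p2 (pred h).

Lemma prd_S (v g : nat) : prd (S ⟨v, g⟩) = g.
Proof. unfold prd; cbn [pred]; apply p2_pair. Qed.

Lemma prd_le (h : nat) : prd h <= h.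
Proof. unfold prd; pose proof (p2_le (pred h)); lia. Qed.

Lemma prd_lt (h : nat) : 0 < h -> prd h < h.
Proof. unfold prd; pose proof (p2_le (pred h)); lia. Qed.

Definition back (h i : nat) : nat :=
  prec (fun a => a) (fun p => p2 (pred (p2 (p2 p)))) h i.

Lemma back_S (h i : nat) : back h (S i) = prd (back h i).
Proof. unfold back; cbn [prec]; psimp; reflexivity. Qed.

Lemma back_prd (h i : nat) : back h (S i) = back (prd h) i.
Proof.
  induction i as [|i IH]; [apply back_S|].
  rewrite back_S, IH, <- back_S; reflexivity.
Qed.

(** Predecessors decrease strictly until 0 is reached, so [h] steps back trace the whole path. *)
Lemma chain_iff (W : Ensemble nat) (h : nat) :
  chain W h <-> forall i, i < S h ->
    back h i = 0 \/ ~ W ⟨p2 (pred (back h i)), p1 (pred (back h i))⟩.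
Proof.
  split.
  - intros H i _; revert i; induction H as [|g v Hg IH Hv]; intro i.
    + left; induction i as [|i IH]; [reflexivity|].
      rewrite back_S, IH; pose proof (prd_le 0); lia.
    + destruct i as [|i].
      * right; unfold back; cbn [prec pred]; psimp; exact Hv.
      * rewrite back_prd, prd_S; apply IH.
  - induction h as [h IH] using lt_wf_ind; intro H.
    destruct h as [|m]; [constructor|].
    rewrite <- (pair_eta m); constructor.
    + pose proof (p2_le m); apply IH; [lia|]; intros i Hi.
      specialize (H (S i) ltac:(lia)); rewrite back_prd in H; exact H.
    + destruct (H 0 ltac:(lia)) as [C|C]; [discriminate|exact C].
Qed.

Lemma ce_not_chain (W : Ensemble nat) : ce W -> ce (fun h => ~ chain W h).
Proof.
  intro HW; apply ce_ext with (fun h => exists i, i < S h /\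
    (back h i <> 0 /\ W ⟨p2 (pred (back h i)), p1 (pred (back h i))⟩)).
  - assert (Hb : rec_fun (fun p => back (p1 p) (p2 p))).
    { unfold back.
      apply (rec_prec (fun a => a) (fun p => p2 (pred (p2 (p2 p)))) p1 p2); recf. }
    apply (ce_ex (fun h i => i < S h /\
      (back h i <> 0 /\ W ⟨p2 (pred (back h i)), p1 (pred (back h i))⟩))).
    apply ce_and; [ces|]; apply ce_and.
    + apply ce_dec, dec_not.
      apply (dec_eq (fun p => back (p1 p) (p2 p)) (fun _ => 0)); recf.
    + apply (ce_sub W (fun p => ⟨p2 (pred (back (p1 p) (p2 p))),
        p1 (pred (back (p1 p) (p2 p)))⟩)); [auto|].
      apply (rec_comp (fun y => ⟨p2 (pred y), p1 (pred y)⟩)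
        (fun p => back (p1 p) (p2 p))); [recf|exact Hb].
  - intro h; rewrite chain_iff; split.
    + intros (i & Hi & H1 & H2) H; destruct (H i Hi); contradiction.
    + intro H; apply NNPP; intro N; apply H; intros i Hi; apply NNPP; intro M.
      apply N; exists i; tauto.
Qed.

Lemma chain_prd (W : Ensemble nat) (h : nat) : chain W h -> chain W (prd h).
Proof.
  destruct 1; [|rewrite prd_S; auto].
  pose proof (prd_le 0) as L; replace (prd 0) with 0 by lia; constructor.
Qed.

(** Witnesses are unique, so the chain does not branch: the predecessors of [g] and [h] are
    compared, with induction on [h] and, inside it, on [g]. *)
Lemma chain_consecutive (W : Ensemble nat) :
  (forall g v v', ~ W ⟨g, v⟩ -> ~ W ⟨g, v'⟩ -> v = v') ->
  forall h g, chain W h -> chain W g -> g < h -> g <= prd h.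
Proof.
  intros U h; induction h as [h IHh] using lt_wf_ind.
  intros g; induction g as [g IHg] using lt_wf_ind; intros Hh Hg L.
  destruct Hh as [|h' v Hh' Hv]; [lia|]; rewrite prd_S in *.
  destruct Hg as [|g' v' Hg' Hv']; [lia|].
  destruct (le_lt_dec (S ⟨v', g'⟩) h') as [C|C]; [exact C|exfalso].
  destruct (lt_eq_lt_dec g' h') as [[L'|E]|L'].
  - pose proof (IHh _ L h' ltac:(constructor; auto) Hh' C) as N.
    rewrite prd_S in N; lia.
  - subst g'; rewrite (U _ _ _ Hv Hv') in L; lia.
  - pose proof (le_pair_r v' g').
    pose proof (IHg g' ltac:(lia) ltac:(constructor; auto) Hg' ltac:(lia)); lia.
Qed.

Lemma chain_unbounded (W : Ensemble nat) :
  (forall g, exists v, ~ W ⟨g, v⟩) -> forall n, exists h, chain W h /\ n <= h.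
Proof.
  intros H n; induction n as [|n (h & Hh & L)]; [exists 0; split; [constructor|lia]|].
  destruct (H h) as [v Hv]; exists (S ⟨v, h⟩); split; [constructor; auto|].
  pose proof (le_pair_r v h); lia.
Qed.

(** Because of the cut at the predecessor, the columns up to a chain element [g] involve [A] only
    below [prd g]. *)
Definition Zchain (W A : Ensemble nat) : Ensemble nat :=
  fun n => ~ chain W (p2 n) \/ (A (p1 n) /\ p1 n < prd (p2 n)).

(** [Zfin L V] agrees with [Zchain W A] on the columns up to [g] and fills the others, hence
    contains it. Conversely, a true fact is verified by the modulus of [g], so its use lies below
    the next chain element, and all columns it meets beyond [g] are filled in [Zchain W A] too. *)
Lemma Zchain_facts (W A : Ensemble nat) (g j x L V : nat) :
  (forall g, exists v, ~ W ⟨g, v⟩) ->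
  (forall g v v', ~ W ⟨g, v⟩ -> ~ W ⟨g, v'⟩ -> v = v') ->
  (forall g v q, ~ W ⟨g, v⟩ -> q < fact_range g -> fact q ->
     exists s, s <= v /\ fact_by q s) ->
  chain W g -> j <= g -> x <= g ->
  (forall k, fin_set L k <-> k <= g /\ chain W k) ->
  (forall n, fin_set V n <-> n <= ⟨g, g⟩ /\ fin_set L (p2 n) /\ A (p1 n) /\
     p1 n < prd (p2 n)) ->
  Gam j (Zchain W A) x <-> fact ⟨⟨j, x⟩, ⟨L, V⟩⟩.
Proof.
  intros HW U HF Cg Hj Hx HL HV; split.
  - unfold fact; psimp; intros (u & Hu & G); exists u; split; [|exact G].
    intros n Hn; apply Hu in Hn; unfold Zfin; destruct (classic (fin_set L (p2 n)))
      as [I|I]; [right|left; exact I].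
    pose proof (proj1 (HL _) I) as [Lg Cp].
    destruct Hn as [Hn|[Hn Hl]]; [contradiction|]; apply HV.
    split; [|auto]; rewrite <- (pair_eta n); apply pair_mono; [|auto].
    pose proof (prd_le (p2 n)); lia.
  - intro F; destruct (HW g) as [v Hv].
    assert (Hq : ⟨⟨j, x⟩, ⟨L, V⟩⟩ < fact_range g).
    { apply fact_range_bound; auto; apply fin_set_lt_pow2; intros i Hi.
      - apply HL in Hi; pose proof (le_pair_l g g); lia.
      - apply HV in Hi; lia. }
    destruct (HF g v _ Hv Hq F) as (s & Ls & H1 & H2); psimp; exists (p1 s).
    split; [|apply gamma_halts; eauto].
    apply fin_set_sub_iff in H1; intros i Hi; pose proof (fin_set_lt _ _ Hi).
    pose proof (p1_le s); apply H1 in Hi; unfold Zchain.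
    destruct Hi as [Hi|Hi]; [|apply HV in Hi; right; apply Hi].
    left; intro C; apply Hi, HL; split; [|exact C].
    assert (Cn : chain W (S ⟨v, g⟩)) by (constructor; auto).
    pose proof (chain_consecutive W U _ _ Cn C) as N; rewrite prd_S in N.
    apply N; pose proof (p2_le i); pose proof (le_pair_l v g); lia.
Qed.

Lemma e_le_Zchain (W A : Ensemble nat) : ce W -> e_le (Zchain W A) A.
Proof.
  intro HW; pose proof (ce_not_chain W HW); pose proof (e_refl A).
  unfold Zchain, prd; es.
Qed.

(** If [A] is [Gam j] of [Zchain W A], then facts decidable in [zero_jump] compute [A] up to [g]
    from [A] below [prd g]. Recursion along the chain determines [A], so nonmembership also has an
    existential description. *)
Lemma Delta2_of_e_le_Zchain (W A : Ensemble nat) :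
  ce W -> (forall g, exists v, ~ W ⟨g, v⟩) ->
  (forall g v v', ~ W ⟨g, v⟩ -> ~ W ⟨g, v'⟩ -> v = v') ->
  (forall g v q, ~ W ⟨g, v⟩ -> q < fact_range g -> fact q ->
     exists s, s <= v /\ fact_by q s) ->
  e_le A (Zchain W A) -> e_le (fun x => ~ A x) zero_jump.
Proof.
  intros HW Hex U HF HA; apply e_le_Gam in HA; destruct HA as [j HA].
  pose proof (ce_not_chain W HW) as HN.
  assert (HC : e_le (chain W) zero_jump).
  { apply e_ext with (fun h => ~ ~ chain W h); [apply e_jump_co_ce, HN|].
    intro h; tauto. }
  pose proof ce_fact as Hf.
  assert (Hnf : e_le (fun q => ~ fact q) zero_jump) by apply e_jump_co_ce, ce_fact.
  (* The recursion needs [j <= g]; the segment of [A] up to [j] is supplied as a constant. *)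
  destruct (fin_set_comprehension A (S j)) as [A0 HA0].
  (* [c] is a candidate for an initial segment of [A], checked link by link: its
     part below [prd g] determines, through the decidable facts about [L] and
     [V], its part up to [g]. *)
  apply e_ext with (fun x => exists h, exists c,
    chain W h /\ x <= h /\ ~ fin_set c x /\
    (forall y, y < S j -> (fin_set c y -> fin_set A0 y) /\ (fin_set A0 y -> fin_set c y)) /\
    forall g, g < S h -> ~ chain W g \/ (g < S j \/ exists L, exists V,
      (forall k, k < S (L + g) -> fin_set L k /\ (k <= g /\ chain W k) \/
                                  ~ fin_set L k /\ (g < k \/ ~ chain W k)) /\
      (forall n, n < S (V + ⟨g, g⟩) ->
        (fin_set V n -> n <= ⟨g, g⟩ /\ fin_set L (p2 n) /\ fin_set c (p1 n) /\
           p1 n < prd (p2 n)) /\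
        (n <= ⟨g, g⟩ /\ fin_set L (p2 n) /\ fin_set c (p1 n) /\ p1 n < prd (p2 n) ->
         fin_set V n)) /\
      forall x', x' < S g -> fin_set c x' /\ fact ⟨⟨j, x'⟩, ⟨L, V⟩⟩ \/
                             ~ fin_set c x' /\ ~ fact ⟨⟨j, x'⟩, ⟨L, V⟩⟩)).
  { unfold prd; es. }
  intro x; split.
  - intros (h & c & Ch & Lx & Nx & H0 & Hg) Ax; apply Nx.
    (* Every accepted candidate is correct, by induction along the chain. *)
    assert (HH : forall g, chain W g -> g <= h -> forall y, y <= g ->
      (fin_set c y <-> A y)).
    { intro g; induction g as [g IH] using lt_wf_ind; intros Cg Lg.
      destruct (le_lt_dec (S j) g) as [G|G].
      - destruct (Hg g ltac:(lia)) as [N|[N|(L & V & HL & HV & HX)]];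
          [contradiction|lia|].
        assert (HL' : forall k, fin_set L k <-> k <= g /\ chain W k).
        { intro k; destruct (le_lt_dec (S (L + g)) k) as [M|M].
          - split; [intro I; apply fin_set_lt in I; lia|lia].
          - specialize (HL k M); destruct HL as [HL|[HL [HL'|HL']]];
              [tauto| |tauto].
            split; [tauto|lia]. }
        assert (HV' : forall n, fin_set V n <-> n <= ⟨g, g⟩ /\ fin_set L (p2 n) /\
          A (p1 n) /\ p1 n < prd (p2 n)).
        { intro n.
          assert (Hc : fin_set L (p2 n) -> p1 n < prd (p2 n) ->
            (fin_set c (p1 n) <-> A (p1 n))).
          { intros I M; apply HL' in I; destruct I as [I1 I2].
            assert (prd (p2 n) <= prd g).
            { destruct (Nat.eq_dec (p2 n) g) as [->|E]; [lia|].
              pose proof (chain_consecutive W U _ _ Cg I2 ltac:(lia)).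
              pose proof (prd_le (p2 n)); lia. }
            apply (IH (prd g)); [apply prd_lt; lia|apply chain_prd; auto| |lia].
            pose proof (prd_le g); lia. }
          destruct (le_lt_dec (S (V + ⟨g, g⟩)) n) as [M|M].
          - split; [intro I; apply fin_set_lt in I; lia|lia].
          - specialize (HV n M); destruct HV as [V1 V2]; split.
            + intro I; apply V1 in I; tauto.
            + intros I; apply V2; tauto. }
        intros y Ly; rewrite (HA y).
        rewrite (Zchain_facts W A g j y L V Hex U HF Cg ltac:(lia) Ly HL' HV').
        specialize (HX y ltac:(lia)); tauto.
      - intros y Ly; specialize (H0 y ltac:(lia)); specialize (HA0 y).
        assert (y < S j) by lia; tauto. }
    apply (HH h Ch (le_n _) x Lx), Ax.
  - intro Nx; destruct (chain_unbounded W Hex x) as (h & Ch & Lx).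
    (* The length covers both the links up to [h] and the comparison with [A0]. *)
    destruct (fin_set_comprehension A (S (h + j))) as [c Hc].
    exists h, c; split; [auto|split; [auto|split; [|split]]].
    + intro I; apply Hc in I; tauto.
    + intros y Ly; specialize (HA0 y); specialize (Hc y).
      assert (y < S (h + j)) by lia; tauto.
    + intros g Lg; destruct (classic (chain W g)) as [Cg|Cg]; [right|auto].
      destruct (le_lt_dec (S j) g) as [G|G]; [right|auto].
      destruct (fin_set_comprehension (chain W) (S g)) as [L HL].
      destruct (fin_set_comprehension (fun n => fin_set L (p2 n) /\ A (p1 n) /\
        p1 n < prd (p2 n)) (S ⟨g, g⟩)) as [V HV].
      assert (HL' : forall k, fin_set L k <-> k <= g /\ chain W k)
        by (intro k; rewrite HL, Nat.lt_succ_r; reflexivity).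
      assert (HV' : forall n, fin_set V n <-> n <= ⟨g, g⟩ /\ fin_set L (p2 n) /\
          A (p1 n) /\ p1 n < prd (p2 n))
        by (intro n; rewrite HV, Nat.lt_succ_r; reflexivity).
      exists L, V; split; [|split].
      * intros k _; specialize (HL' k); destruct (classic (fin_set L k)); [tauto|].
        right; split; [auto|]; destruct (le_lt_dec k g); tauto.
      * assert (Hc' : forall n, fin_set L (p2 n) -> p1 n < prd (p2 n) ->
          (fin_set c (p1 n) <-> A (p1 n))).
        { intros n I M; apply HL' in I; destruct I as [I _]; rewrite Hc.
          pose proof (prd_le (p2 n)); assert (p1 n < S (h + j)) by lia; tauto. }
        intros n _; specialize (HV' n); specialize (Hc' n); tauto.
      * intros y Ly.
        pose proof (Zchain_facts W A g j y L V Hex U HF Cg ltac:(lia) ltac:(lia)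
          HL' HV') as E.
        rewrite <- HA in E; specialize (Hc y); assert (y < S (h + j)) by lia.
        destruct (classic (A y)); tauto.
Qed.

(** Either the previous lemma applies, or [Zchain W A] is strictly below [A] and hence below [B].
    Then a position missing from a chain column, in the part that codes, reveals nonmembership in
    [A]. *)
Lemma Ahmad_left_co_e_le (A B : Ensemble nat) :
  Sigma02 A -> Ahmad_pair A B -> e_le (fun x => ~ A x) (jump B).
Proof.
  intros HA [_ HAB].
  destruct fact_settling as (W & HW & Hex & U & HF).
  destruct (classic (e_le A (Zchain W A))) as [L|L].
  - apply e_trans with zero_jump; [|apply zero_jump_le_jump].
    eapply Delta2_of_e_le_Zchain; eauto.
  - pose proof (e_le_Zchain W A HW) as HZ.
    assert (HB : e_le (Zchain W A) B).
    { apply HAB; [apply e_trans with A; auto|split; auto]. }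
    apply e_jump_neg in HB; pose proof (ce_not_chain W HW) as HN.
    assert (HC : e_le (chain W) (jump B)).
    { apply e_ext with (fun h => ~ ~ chain W h); [apply e_jump_co_ce, HN|].
      intro h; tauto. }
    apply e_ext with (fun y => exists h, chain W h /\ y < prd h /\
      ~ Zchain W A ⟨y, h⟩); [unfold prd; es|].
    intro y; unfold Zchain; split.
    + intros (h & Ch & Ly & N) Ay; psimp; apply N; auto.
    + intro N; destruct (chain_unbounded W Hex (S y)) as (h & Ch & Lh).
      (* A column codes only below its predecessor, so the successor of an element above [y] is
         needed. *)
      destruct (Hex h) as [v Hv]; exists (S ⟨v, h⟩).
      split; [constructor; auto|rewrite prd_S; psimp; rewrite prd_S; split; [lia|]].
      intros [C|C]; [apply C; constructor; auto|tauto].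
Qed.

(** * Requirements that [K B] can certify *)

Lemma Gam_mono (j : nat) (X Y : Ensemble nat) (x : nat) :
  (forall n, X n -> Y n) -> Gam j X x -> Gam j Y x.
Proof. intros H (u & Hu & G); exists u; split; [intros i Hi; apply H, Hu, Hi|auto]. Qed.

(* [r] lists the elements below [h] of the set with Pi-1 witnesses outside [W]. *)
Definition true_info (W : Ensemble nat) (h r : nat) : Prop :=
  forall e, fin_set r e <-> p1 e < h /\ ~ W e.

(** Exceeds all that is coded in unrefuted columns up to [h]: positions stop at [r + h], and the
    column is bounded because its guess consists of a subset of [r] and a set of numbers below
    [h]. *)
Definition width (h r : nat) : nat := S ⟨r + h, ⟨h, ⟨r, 2 ^ h⟩⟩⟩.

(* The coding of [A] in the column ⟨h, ⟨r, w⟩⟩ refutes [Γ_i(B)] for [i <= h]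
   below [b]; and if [h] begins a gap without coding, [A <> Γ_j] is witnessed
   below [b] for [j <= h], whatever was coded before. *)
Definition certified (A B W : Ensemble nat) (h q : nat) : Prop :=
  let r := p1 q in let b := p2 q in
  ((forall e, e < r -> ~ fin_set r e \/ (p1 e < h /\ ~ W e)) /\
   (forall z, z < h -> ~ K B z \/ exists v, v < S r /\ fin_set r ⟨z, v⟩)) /\
  (forall i, i < S h -> forall w, w < 2 ^ h -> exists y, y < S b /\
     (A y /\ ~ K B ⟨i, ⟨y, ⟨h, ⟨r, w⟩⟩⟩⟩ \/ ~ A y /\ K B ⟨i, ⟨y, ⟨h, ⟨r, w⟩⟩⟩⟩)) /\
  (forall j, j < S h -> forall L, L < 2 ^ width h r -> forall V, V < 2 ^ width h r ->
     exists x, x < S b /\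
     (A x /\ ~ fact ⟨⟨j, x⟩, ⟨L, V⟩⟩ \/
      ~ A x /\ exists u, u < S b /\
        ((forall i, i < u -> ~ fin_set u i \/ Zfin L V i) /\ gamma j ⟨x, u⟩))).

Lemma e_certified (A B W : Ensemble nat) :
  ce W -> e_le A (jump B) -> e_le (fun x => ~ A x) (jump B) ->
  e_le (fun p => certified A B W (p1 p) (p2 p)) (jump B).
Proof.
  intros HW HA HnA.
  pose proof (e_jump_K B) as HK; pose proof (e_jump_notK B) as HnK.
  assert (HnW : e_le (fun n => ~ W n) (jump B)) by apply e_jump_co_ce, HW.
  assert (Hnf : e_le (fun q => ~ fact q) (jump B)) by apply e_jump_co_ce, ce_fact.
  unfold certified, width, Zfin; cbv zeta; es.
Qed.

(** The certificate asks only that [r] be sound and contain some witness for each element of [K B]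
    below [h]; uniqueness excludes further ones. *)
Lemma certified_true_info (A B W : Ensemble nat) (h q : nat) :
  (forall z, K B z <-> exists v, ~ W ⟨z, v⟩) ->
  (forall z v v', ~ W ⟨z, v⟩ -> ~ W ⟨z, v'⟩ -> v = v') ->
  certified A B W h q -> true_info W h (p1 q).
Proof.
  intros HK U ((H1 & H2) & _) e; split.
  - intro I; destruct (H1 e (fin_set_lt _ _ I)); tauto.
  - intros [L N]; destruct (H2 _ L) as [C|(v & _ & Hv)].
    + exfalso; apply C, HK; exists (p2 e); rewrite pair_eta; exact N.
    + destruct (H1 _ (fin_set_lt _ _ Hv)) as [C|[_ C]]; [contradiction|].
      rewrite <- (pair_eta e) in N |- *; rewrite (U _ _ _ N C); exact Hv.
Qed.

Lemma ball_mono (P : nat -> nat -> Prop) (n : nat) :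
  (forall i b b', b <= b' -> P i b -> P i b') ->
  (forall i, i < n -> exists b, P i b) -> exists b, forall i, i < n -> P i b.
Proof.
  intros M H; apply ball_collection in H; destruct H as [N H]; exists N.
  intros i Hi; destruct (H i Hi) as (b & L & Hb); apply (M i b); [lia|auto].
Qed.

Lemma true_info_exists (W : Ensemble nat) (h : nat) :
  (forall z v v', ~ W ⟨z, v⟩ -> ~ W ⟨z, v'⟩ -> v = v') ->
  exists r, true_info W h r.
Proof.
  intro U.
  destruct (ball_mono (fun z n => forall v, ~ W ⟨z, v⟩ -> ⟨z, v⟩ < n) h) as [N HN].
  - intros i b b' L H v Hv; specialize (H v Hv); lia.
  - intros z _; destruct (classic (exists v, ~ W ⟨z, v⟩)) as [[v Hv]|N].
    + exists (S ⟨z, v⟩); intros v' Hv'; rewrite (U _ _ _ Hv' Hv); lia.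
    + exists 0; intros v Hv; exfalso; eauto.
  - destruct (fin_set_comprehension (fun e => p1 e < h /\ ~ W e) N) as [r Hr].
    exists r; intro e; rewrite Hr; split; [tauto|].
    intros [L H]; split; [|auto].
    rewrite <- (pair_eta e) in H |- *; apply HN; auto.
Qed.

(** Without a bound, [A] would be a section of [K B] in one clause and c.e. in the other; either
    gives [e_le A B]. Monotonicity in [b] turns the finitely many bounds into one. *)
Lemma certified_exists (A B W : Ensemble nat) (h : nat) :
  (forall z, K B z <-> exists v, ~ W ⟨z, v⟩) ->
  (forall z v v', ~ W ⟨z, v⟩ -> ~ W ⟨z, v'⟩ -> v = v') ->
  ~ e_le A B -> exists q, certified A B W h q.
Proof.
  intros HK U HA; destruct (true_info_exists W h U) as [r Hr].
  destruct (ball_mono (fun i b => forall w, w < 2 ^ h -> exists y, y < S b /\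
     (A y /\ ~ K B ⟨i, ⟨y, ⟨h, ⟨r, w⟩⟩⟩⟩ \/ ~ A y /\ K B ⟨i, ⟨y, ⟨h, ⟨r, w⟩⟩⟩⟩)) (S h))
    as [b1 H1].
  { intros i b b' L H w Hw; destruct (H w Hw) as (y & Ly & Hy); exists y.
    split; [lia|auto]. }
  { intros i _; apply ball_mono with (P := fun w b => exists y, y < S b /\
     (A y /\ ~ K B ⟨i, ⟨y, ⟨h, ⟨r, w⟩⟩⟩⟩ \/ ~ A y /\ K B ⟨i, ⟨y, ⟨h, ⟨r, w⟩⟩⟩⟩)).
    - intros w b b' L (y & Ly & Hy); exists y; split; [lia|auto].
    - intros w _; apply NNPP; intro N; apply HA.
      pose proof (e_K B); apply e_ext with (fun y => K B ⟨i, ⟨y, ⟨h, ⟨r, w⟩⟩⟩⟩); [es|].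
      intro y; split; intro Hy; apply NNPP; intro M; apply N; exists y, y;
        (split; [lia|tauto]). }
  destruct (ball_mono (fun j b =>
    forall L, L < 2 ^ width h r -> forall V, V < 2 ^ width h r ->
     exists x, x < S b /\
     (A x /\ ~ fact ⟨⟨j, x⟩, ⟨L, V⟩⟩ \/
      ~ A x /\ exists u, u < S b /\
        ((forall i, i < u -> ~ fin_set u i \/ Zfin L V i) /\ gamma j ⟨x, u⟩))) (S h))
    as [b2 H2].
  { intros j b b' Lb H L HL V HV; destruct (H L HL V HV) as (x & Lx & Hx); exists x.
    split; [lia|]; destruct Hx as [Hx|(Hx & u & Lu & Hu)]; [auto|right].
    split; [auto|]; exists u; split; [lia|auto]. }
  { intros j _.
    apply ball_mono with (P := fun L b => forall V, V < 2 ^ width h r ->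
     exists x, x < S b /\
     (A x /\ ~ fact ⟨⟨j, x⟩, ⟨L, V⟩⟩ \/
      ~ A x /\ exists u, u < S b /\
        ((forall i, i < u -> ~ fin_set u i \/ Zfin L V i) /\ gamma j ⟨x, u⟩))).
    - intros L b b' Lb H V HV; destruct (H V HV) as (x & Lx & Hx); exists x.
      split; [lia|]; destruct Hx as [Hx|(Hx & u & Lu & Hu)]; [auto|right].
      split; [auto|]; exists u; split; [lia|auto].
    - intros L _; apply ball_mono with (P := fun V b => exists x, x < S b /\
       (A x /\ ~ fact ⟨⟨j, x⟩, ⟨L, V⟩⟩ \/
        ~ A x /\ exists u, u < S b /\
        ((forall i, i < u -> ~ fin_set u i \/ Zfin L V i) /\ gamma j ⟨x, u⟩))).
      + intros V b b' Lb (x & Lx & Hx); exists x.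
        split; [lia|]; destruct Hx as [Hx|(Hx & u & Lu & Hu)]; [auto|right].
        split; [auto|]; exists u; split; [lia|auto].
      + intros V _; apply NNPP; intro N; apply HA, e_ce.
        pose proof ce_fact as Hf.
        apply ce_ext with (fun x => fact ⟨⟨j, x⟩, ⟨L, V⟩⟩); [ces|].
        intro x; split; intro Hx; apply NNPP; intro M; apply N.
        * pose proof Hx as (u & Hu & G); psimp.
          (* The bound must cover the argument and the finite set used. *)
          exists (x + u), x; split; [lia|right; split; [auto|]].
          exists u; split; [lia|split; [apply fin_set_sub_iff, Hu|exact G]].
        * exists x, x; split; [lia|auto]. }
  exists ⟨r, b1 + b2⟩; unfold certified; cbv zeta; psimp.
  split; [split|split].
  - intros e _; destruct (classic (fin_set r e)) as [I|I]; [right; apply Hr, I|auto].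
  - intros z Hz; destruct (classic (K B z)) as [I|I]; [right|auto].
    apply HK in I; destruct I as [v Hv].
    assert (I : fin_set r ⟨z, v⟩) by (apply Hr; psimp; auto).
    exists v; split; [|exact I]; apply fin_set_lt in I.
    pose proof (le_pair_r z v); lia.
  - intros i Hi w Hw; destruct (H1 i Hi w Hw) as (y & Ly & Hy); exists y.
    split; [lia|auto].
  - intros j Hj L HL V HV; destruct (H2 j Hj L HL V HV) as (x & Lx & Hx); exists x.
    split; [lia|]; destruct Hx as [Hx|(Hx & u & Lu & Hu)]; [auto|right].
    split; [auto|]; exists u; split; [lia|auto].
Qed.

(** * Parity counts *)

Fixpoint odd_count (P : nat -> Prop) (n : nat) : Prop :=
  match n with
  | 0 => False
  | S m => P m /\ ~ odd_count P m \/ ~ P m /\ odd_count P m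
  end.

Lemma odd_count_ext (P Q : nat -> Prop) (n : nat) :
  (forall i, i < n -> (P i <-> Q i)) -> (odd_count P n <-> odd_count Q n).
Proof.
  induction n as [|n IH]; intro H; cbn [odd_count]; [tauto|].
  rewrite (H n) by lia; rewrite IH by (intros; apply H; lia); tauto.
Qed.

Lemma dec_odd_count (P : nat -> nat -> Prop) (b : nat -> nat) :
  rec_pred (fun p => P (p1 p) (p2 p)) -> rec_fun b ->
  rec_pred (fun x => odd_count (P x) (b x)).
Proof.
  intros (f & Hf & H) Hb.
  (* The state is 0 for odd and 1 for even, and flips at each [n] satisfying [P x]. *)
  exists (fun x => prec (fun _ => 1) (fun p =>
    (1 - f ⟨p1 p, p1 (p2 p)⟩) * (1 - p2 (p2 p)) +
    (1 - (1 - f ⟨p1 p, p1 (p2 p)⟩)) * p2 (p2 p)) x (b x)).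
  split; [apply rec_prec; recf|].
  intro x.
  enough (E : forall n, let s := prec (fun _ => 1) (fun p =>
    (1 - f ⟨p1 p, p1 (p2 p)⟩) * (1 - p2 (p2 p)) +
    (1 - (1 - f ⟨p1 p, p1 (p2 p)⟩)) * p2 (p2 p)) x n in
    s <= 1 /\ (odd_count (P x) n <-> s = 0)) by apply E.
  induction n as [|n IH]; cbn [prec odd_count]; cbv zeta in *; [split; [lia|]|].
  - split; [tauto|lia].
  - revert IH; generalize (prec (fun _ => 1) (fun p =>
      (1 - f ⟨p1 p, p1 (p2 p)⟩) * (1 - p2 (p2 p)) +
      (1 - (1 - f ⟨p1 p, p1 (p2 p)⟩)) * p2 (p2 p)) x n).
    intros s [Ls IH]; specialize (H ⟨x, n⟩); psimp; rewrite H, IH.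
    destruct (f ⟨x, n⟩) as [|m], s as [|s]; lia.
Qed.

Lemma odd_count_const (P : nat -> Prop) (m n : nat) :
  m <= n -> (forall i, m <= i -> i < n -> ~ P i) ->
  (odd_count P n <-> odd_count P m).
Proof.
  induction 1 as [|n L IH]; intro H; [tauto|]; cbn [odd_count].
  pose proof (H n L ltac:(lia)); rewrite IH by (intros; apply H; lia); tauto.
Qed.

(** Passing an element of [P] flips the parity, so one of two consecutive elements has the desired
    one. *)
Lemma both_parities (P : nat -> Prop) (c : Prop) :
  (forall n, exists h, n <= h /\ P h) ->
  forall n, exists h, n <= h /\ P h /\ (odd_count P h <-> c).
Proof.
  intros H n; destruct (H n) as (h & Lh & Ph).
  destruct (classic (odd_count P h <-> c)) as [E|E]; [eauto|].
  destruct (least_witness (fun h' => S h <= h' /\ P h') (H (S h)))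
    as (h' & [L' P'] & M).
  exists h'; split; [lia|split; [auto|]].
  rewrite (odd_count_const P (S h) h' L').
  - cbn [odd_count]; tauto.
  - intros i Li Li' Pi; apply (M i Li'); auto.
Qed.

(** * Coding [A] along a Pi-1 set *)

(* [p] is [q] together with a computation of [certified _ _ _ h q] from the
   oracle [Q], all of it below the next element of [T]. *)
Definition good_by (R : nat -> nat -> Prop) (Q T : nat -> Prop) (h p : nat) : Prop :=
  R ⟨h, p1 p⟩ (p2 p) /\ oracle_ok Q (p1 (p2 p)) /\
  forall g, g < S p -> ~ h < g \/ ~ T g.

Definition good (R : nat -> nat -> Prop) (Q T : nat -> Prop) (h : nat) : Prop :=
  T h /\ exists p, good_by R Q T h p.

Definition info_dom (r z : nat) : Prop := exists v, v < S r /\ fin_set r ⟨z, v⟩.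

(** Goodness computed from the guess alone, and therefore decidable. The bound [p < p1 l] loses
    nothing for a true guess, since a witness must precede the next element of [T]. *)
Definition seems_good (R : nat -> nat -> Prop) (l g : nat) : Prop :=
  fin_set (p2 (p2 l)) g /\
  exists p, p < p1 l /\ good_by R (info_dom (p1 (p2 l))) (fin_set (p2 (p2 l))) g p.

(** Enumeration refutes only the false claims of a guess. Omissions are handled in [Zcol]: an
    omitted true witness ⟨z, v⟩ with [z < p1 l] blocks coding from [v] on, and an omitted element of
    [T] below [p1 l] blocks it altogether. *)
Definition dead (T W : Ensemble nat) (l : nat) : Prop :=
  ~ T (p1 l) \/
  (exists e, e < p1 (p2 l) /\ (fin_set (p1 (p2 l)) e /\ (p1 l <= p1 e \/ W e))) \/
  (exists g, g < p2 (p2 l) /\ (fin_set (p2 (p2 l)) g /\ (p1 l <= g \/ ~ T g))).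

(* Column [l] = ⟨h, ⟨r, w⟩⟩ belongs to the guess that [h] is in [T], that [r] is
   the true information about [K B] below [h], and that [w] is [T] below [h].
   It codes [A] up to the next element of [T] if the guess is right and the
   number of good elements of [T] below [h] is even; wrong guesses are either
   filled or code only finitely much. *)
Definition Zcol (A T W : Ensemble nat) (R : nat -> nat -> Prop) : Ensemble nat :=
  fun n => let y := p1 n in let l := p2 n in
  dead T W l \/
  (A y /\ (forall g, g < S y -> ~ p1 l < g \/ ~ T g) /\
   (forall z, z < p1 l -> forall v, v < S y -> fin_set (p1 (p2 l)) ⟨z, v⟩ \/ W ⟨z, v⟩) /\
   (forall g, g < p1 l -> fin_set (p2 (p2 l)) g \/ ~ T g) /\
   ~ odd_count (seems_good R l) (p1 l)).

Lemma e_Zcol (A T W : Ensemble nat) (R : nat -> nat -> Prop) :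
  ce (fun h => ~ T h) -> ce W -> rec_pred (fun p => R (p1 p) (p2 p)) ->
  e_le (Zcol A T W R) A.
Proof.
  intros HT HW HR; pose proof (e_refl A) as HA.
  assert (HS : rec_pred (fun l => odd_count (seems_good R l) (p1 l))).
  { apply dec_odd_count; [|recf].
    unfold seems_good, good_by, oracle_ok, info_dom; decs. }
  assert (HD : ce (dead T W)) by (unfold dead; ces).
  unfold Zcol; cbv zeta.
  apply e_or; [es|]; repeat (apply e_and; [es|]); apply e_dec, dec_not.
  apply (dec_sub (fun l => odd_count (seems_good R l) (p1 l))); [exact HS|recf].
Qed.

Lemma oracle_elem_lt (p z : nat) :
  z < p1 (p1 (p2 p)) \/ z < p2 (p1 (p2 p)) -> z < p.
Proof.
  pose proof (p1_le (p1 (p2 p))); pose proof (p2_le (p1 (p2 p)));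
    pose proof (p1_le (p2 p)); pose proof (p2_le p); lia.
Qed.

(** As [h] is in [T], goodness of [g < h] is witnessed by some [p < h]; its oracle questions are
    smaller still, and there [r] answers correctly. *)
Lemma seems_good_iff (B T W : Ensemble nat) (R : nat -> nat -> Prop) (h r w g : nat) :
  (forall z, K B z <-> exists v, ~ W ⟨z, v⟩) ->
  T h -> true_info W h r -> (forall g, fin_set w g <-> g < h /\ T g) -> g < h ->
  (seems_good R ⟨h, ⟨r, w⟩⟩ g <-> good R (K B) T g).
Proof.
  intros HK Th Hr Hw Lg; unfold seems_good, good, good_by; psimp.
  assert (HQ : forall z, z < h -> (info_dom r z <-> K B z)).
  { intros z Lz; rewrite HK; unfold info_dom; split.
    - intros (v & _ & Hv); apply Hr in Hv; exists v; tauto.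
    - intros [v Hv]; assert (I : fin_set r ⟨z, v⟩) by (apply Hr; psimp; auto).
      exists v; split; [|exact I]; apply fin_set_lt in I.
      pose proof (le_pair_r z v); lia. }
  assert (HO : forall p, p <= h ->
    (oracle_ok (info_dom r) (p1 (p2 p)) <-> oracle_ok (K B) (p1 (p2 p)))).
  { intros p Lp; unfold oracle_ok; split; intros [O1 O2]; split; intros z Lz;
      pose proof (oracle_elem_lt p z ltac:(auto));
      specialize (HQ z ltac:(lia));
      first [specialize (O1 z Lz)|specialize (O2 z Lz)]; tauto. }
  rewrite Hw; split.
  - intros ((_ & Tg) & p & Lp & H1 & H2 & H3); split; [auto|]; exists p.
    split; [auto|split; [apply HO; [lia|auto]|]].
    intros k Lk; specialize (H3 k Lk); specialize (Hw k).
    assert (k < h) by lia; tauto.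
  - intros (Tg & p & H1 & H2 & H3); split; [auto|].
    assert (Lp : p < h).
    { destruct (le_lt_dec h p) as [L|L]; [|exact L].
      destruct (H3 h ltac:(lia)); [lia|contradiction]. }
    exists p; split; [auto|split; [auto|split; [apply HO; [lia|auto]|]]].
    intros k Lk; specialize (H3 k Lk); specialize (Hw k); tauto.
Qed.

Lemma alive_true_info (T W : Ensemble nat) (h r w : nat) :
  T h -> true_info W h r -> (forall g, fin_set w g <-> g < h /\ T g) ->
  ~ dead T W ⟨h, ⟨r, w⟩⟩.
Proof.
  intros Th Hr Hw; unfold dead; psimp.
  intros [C|[(e & _ & I & C)|(g & _ & I & C)]]; [contradiction| |].
  - apply Hr in I; destruct I as [I1 I2]; destruct C; [lia|contradiction].
  - apply Hw in I; destruct I as [I1 I2]; destruct C; [lia|contradiction].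
Qed.

(** In the even case the column of the true guess copies [A] up to [p], since no element of [T]
    intervenes. The certified bound is at most [p], so the certified disagreement occurs within this
    copy. *)
Lemma Zcol_not_Gam_B (A B T W : Ensemble nat) (R : nat -> nat -> Prop)
    (h i p w : nat) :
  (forall z, K B z <-> exists v, ~ W ⟨z, v⟩) ->
  (forall z v v', ~ W ⟨z, v⟩ -> ~ W ⟨z, v'⟩ -> v = v') ->
  T h -> certified A B W h (p1 p) -> (forall g, g < S p -> ~ h < g \/ ~ T g) ->
  (forall g, fin_set w g <-> g < h /\ T g) ->
  ~ odd_count (seems_good R ⟨h, ⟨p1 (p1 p), w⟩⟩) h -> i <= h ->
  ~ forall n, Zcol A T W R n <-> Gam i B n.
Proof.
  intros HK U Th HC HT Hw HO Li E.
  pose proof (certified_true_info A B W h _ HK U HC) as Hr.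
  destruct HC as (_ & HC & _).
  destruct (HC i ltac:(lia) w) as (y & Ly & Hy).
  { apply fin_set_lt_pow2; intros g Hg; apply Hw in Hg; tauto. }
  set (r := p1 (p1 p)) in *.
  specialize (E ⟨y, ⟨h, ⟨r, w⟩⟩⟩).
  assert (EZ : Zcol A T W R ⟨y, ⟨h, ⟨r, w⟩⟩⟩ <-> A y).
  { unfold Zcol; cbv zeta; psimp; split.
    - intros [D|D]; [destruct (alive_true_info T W h r w Th Hr Hw D)|tauto].
    - intro Ay; right; split; [auto|split; [|split; [|split]]].
      + intros g Lg; apply HT; pose proof (p2_le (p1 p)); pose proof (p1_le p); lia.
      + intros z Lz v _; destruct (classic (W ⟨z, v⟩)) as [I|I]; [auto|left].
        apply Hr; psimp; auto.
      + intros g Lg; destruct (classic (T g)); [left; apply Hw|]; auto.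
      + exact HO. }
  rewrite K_iff in Hy; psimp; tauto.
Qed.

(** In the odd case the unrefuted columns up to [h] code boundedly much, and columns beyond [h] met
    up to [p] are filled. So [Zcol] is contained in some [Zfin L V] and agrees with it up to [p],
    and the certified disagreement transfers. *)
Lemma A_not_Gam_Zcol (A B T W : Ensemble nat) (R : nat -> nat -> Prop)
    (h j p w : nat) :
  (forall z, K B z <-> exists v, ~ W ⟨z, v⟩) ->
  (forall z v v', ~ W ⟨z, v⟩ -> ~ W ⟨z, v'⟩ -> v = v') ->
  T h -> certified A B W h (p1 p) -> (forall g, g < S p -> ~ h < g \/ ~ T g) ->
  (forall g, fin_set w g <-> g < h /\ T g) ->
  odd_count (seems_good R ⟨h, ⟨p1 (p1 p), w⟩⟩) h -> j <= h ->
  ~ forall x, A x <-> Gam j (Zcol A T W R) x.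
Proof.
  intros HK U Th HC HT Hw HO Lj E.
  pose proof (certified_true_info A B W h _ HK U HC) as Hr.
  destruct HC as (_ & _ & HC); set (r := p1 (p1 p)) in *; set (b := p2 (p1 p)) in *.
  (* An unrefuted guess at or before [h] makes no false claim, so only boundedly many such columns
     exist. *)
  assert (Hdead : forall l, ~ dead T W l -> p1 l <= h ->
    Included nat (fin_set (p1 (p2 l))) (fin_set r) /\
    (forall g, fin_set (p2 (p2 l)) g -> g < p1 l /\ T g) /\
    l <= ⟨h, ⟨r, 2 ^ h⟩⟩).
  { intros l D Ll; unfold dead in D.
    assert (D1 : Included nat (fin_set (p1 (p2 l))) (fin_set r)).
    { intros e He; apply Hr; split.
      - destruct (le_lt_dec (p1 l) (p1 e)); [|lia].
        exfalso; apply D; right; left; exists e; split; [apply fin_set_lt|]; auto.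
      - intro C; apply D; right; left; exists e; split; [apply fin_set_lt|]; auto. }
    assert (D2 : forall g, fin_set (p2 (p2 l)) g -> g < p1 l /\ T g).
    { intros g Hg; split.
      - destruct (le_lt_dec (p1 l) g); [|lia].
        exfalso; apply D; right; right; exists g; split; [apply fin_set_lt|]; auto.
      - apply NNPP; intro C; apply D; right; right; exists g.
        split; [apply fin_set_lt|]; auto. }
    split; [auto|split; [auto|]].
    rewrite <- (pair_eta l), <- (pair_eta (p2 l)).
    repeat apply pair_mono; [auto|apply fin_set_le, D1|].
    apply Nat.lt_le_incl, fin_set_lt_pow2; intros g Hg; apply D2 in Hg; lia. }
  (* Before [h], coding stops because [h] is in [T]. At [h], a witness missing from the guess stops
     it below [r]; if none is missing, coding would force the guess to be the true one, which codes
     nothing by parity. *)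
  assert (Hcoded : forall n, Zcol A T W R n -> p1 (p2 n) <= h -> ~ dead T W (p2 n) ->
    n < width h r).
  { intros n HZ Ll D; destruct (Hdead _ D Ll) as (D1 & D2 & D3).
    unfold width; apply le_n_S; rewrite <- (pair_eta n); apply pair_mono; [|auto].
    destruct HZ as [HZ|(_ & Z1 & Z2 & Z3 & Z4)]; [contradiction|].
    destruct (classic (exists e, fin_set r e /\ ~ fin_set (p1 (p2 (p2 n))) e))
      as [(e & I & N)|N].
    - destruct (Nat.eq_dec (p1 (p2 n)) h) as [Eh|Eh].
      + apply NNPP; intro M; apply N.
        pose proof (fin_set_lt _ _ I); pose proof (p2_le e).
        apply Hr in I; destruct I as [I1 I2].
        destruct (Z2 (p1 e) ltac:(lia) (p2 e) ltac:(lia)) as [C|C];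
          rewrite pair_eta in C; [auto|contradiction].
      + destruct (le_lt_dec (p1 n) (r + h)); [auto|].
        destruct (Z1 h ltac:(lia)); [lia|contradiction].
    - destruct (Nat.eq_dec (p1 (p2 n)) h) as [Eh|Eh].
      + exfalso; apply Z4.
        assert (Er : p1 (p2 (p2 n)) = r).
        { apply fin_set_ext; intro e; split; [apply D1|].
          intro I; apply NNPP; intro M; apply N; eauto. }
        assert (Ew : p2 (p2 (p2 n)) = w).
        { apply fin_set_ext; intro g; rewrite Hw, <- Eh; split; [apply D2|].
          intros [L1 L2]; destruct (Z3 g L1); [auto|contradiction]. }
        rewrite Eh; replace (p2 n) with ⟨h, ⟨r, w⟩⟩; [exact HO|].
        rewrite <- Er, <- Ew, <- Eh, !pair_eta; reflexivity.
      + destruct (le_lt_dec (p1 n) (r + h)); [auto|].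
        destruct (Z1 h ltac:(lia)); [lia|contradiction]. }
  destruct (fin_set_comprehension (fun l => p1 l <= h /\ ~ dead T W l) (width h r))
    as [L HL].
  destruct (fin_set_comprehension (fun n => Zcol A T W R n) (width h r)) as [V HV].
  assert (Hup : forall n, Zcol A T W R n -> Zfin L V n).
  { intros n Hn; destruct (classic (fin_set L (p2 n))) as [I|I]; [right|left; exact I].
    apply HL in I; apply HV; split; [apply Hcoded; tauto|auto]. }
  assert (Hdown : forall n, n <= p -> Zfin L V n -> Zcol A T W R n).
  { intros n Ln [Hn|Hn]; [|apply HV in Hn; tauto].
    destruct (classic (dead T W (p2 n))) as [D|D]; [left; exact D|exfalso].
    destruct (le_lt_dec (p1 (p2 n)) h) as [Lh|Lh].
    - apply Hn, HL; split; [|auto]; destruct (Hdead _ D Lh) as (_ & _ & D3).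
      unfold width; pose proof (le_pair_r (r + h) ⟨h, ⟨r, 2 ^ h⟩⟩); lia.
    - assert (T (p1 (p2 n))) by (apply NNPP; intro C; apply D; left; exact C).
      pose proof (p1_le (p2 n)); pose proof (p2_le n).
      destruct (HT (p1 (p2 n)) ltac:(lia)); contradiction. }
  destruct (HC j ltac:(lia) L) with (V := V) as (x & Lx & Hx).
  { apply fin_set_lt_pow2; intros l Hl; apply HL in Hl; tauto. }
  { apply fin_set_lt_pow2; intros l Hl; apply HV in Hl; tauto. }
  destruct Hx as [[Ax N]|(Nx & u & Lu & Hu & G)].
  - apply N; unfold fact; psimp; apply (Gam_mono _ (Zcol A T W R)); [exact Hup|].
    apply E, Ax.
  - apply Nx, E; exists u; split; [|exact G].
    apply fin_set_sub_iff in Hu; intros k Hk; apply Hdown; [|apply Hu, Hk].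
    apply fin_set_lt in Hk; pose proof (p2_le (p1 p)); pose proof (p1_le p).
    unfold b in *; lia.
Qed.

(** Infinitely many good elements would realize both parities beyond every index, so [Zcol] would
    neither compute [A] nor be below [B]. *)
Lemma Ahmad_good_bounded (A B T W : Ensemble nat) (R : nat -> nat -> Prop) :
  Sigma02 A -> Ahmad_pair A B -> ce W ->
  (forall z, K B z <-> exists v, ~ W ⟨z, v⟩) ->
  (forall z v v', ~ W ⟨z, v⟩ -> ~ W ⟨z, v'⟩ -> v = v') ->
  rec_pred (fun p => R (p1 p) (p2 p)) ->
  (forall h q w, R ⟨h, q⟩ w -> oracle_ok (K B) (p1 w) -> certified A B W h q) ->
  ce (fun h => ~ T h) ->
  exists k, forall h, k <= h -> ~ good R (K B) T h.
Proof.
  intros HA [_ HAB] HW HK U HR HRC HT; apply NNPP; intro N.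
  assert (HG : forall n, exists h, n <= h /\ good R (K B) T h).
  { intro n; apply NNPP; intro M; apply N; exists n; intros h Lh Gh; apply M; eauto. }
  pose proof (e_Zcol A T W R HT HW HR) as HZ.
  assert (Hgood : forall h, good R (K B) T h -> exists p w,
    T h /\ certified A B W h (p1 p) /\ (forall g, g < S p -> ~ h < g \/ ~ T g) /\
    (forall g, fin_set w g <-> g < h /\ T g) /\
    (odd_count (seems_good R ⟨h, ⟨p1 (p1 p), w⟩⟩) h <->
     odd_count (good R (K B) T) h)).
  { intros h (Th & p & H1 & H2 & H3).
    assert (HC : certified A B W h (p1 p)) by (eapply HRC; eauto).
    destruct (fin_set_comprehension T h) as [w Hw].
    exists p, w; split; [auto|split; [auto|split; [auto|split; [auto|]]]].
    apply odd_count_ext; intros g Lg; apply (seems_good_iff B T W); auto.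
    eapply certified_true_info; eauto. }
  assert (HnA : ~ e_le A (Zcol A T W R)).
  { intro L; apply e_le_Gam in L; destruct L as [j E].
    (* [True] asks for an odd count, where nothing is coded; [False] below asks for an even one. *)
    destruct (both_parities _ True HG j) as (h & Lh & Gh & O).
    destruct (Hgood h Gh) as (p & w & Th & HC & H3 & Hw & EO).
    eapply (A_not_Gam_Zcol A B T W R h j p w); eauto; tauto. }
  assert (HB : e_le (Zcol A T W R) B).
  { apply HAB; [apply e_trans with A; auto|split; auto]. }
  apply e_le_Gam in HB; destruct HB as [i E].
  destruct (both_parities _ False HG i) as (h & Lh & Gh & O).
  destruct (Hgood h Gh) as (p & w & Th & HC & H3 & Hw & EO).
  eapply (Zcol_not_Gam_B A B T W R h i p w); eauto; tauto.
Qed.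

(** * Pi-3 sets as infinite Pi-1 sets *)

(** The complement of [P] says that a Sigma-2 property holds for all [m]. Its initial conjunctions
    have unique Pi-1 witnesses, and the pairs of a length with such a witness are infinitely many
    exactly when all conjunctions hold. *)
Lemma Pi3_infinite (P : Ensemble nat) :
  e_le P (jump zero_jump) ->
  exists N, ce N /\
    forall n, ~ P n <-> forall k, exists h, k <= h /\ ~ N ⟨n, h⟩.
Proof.
  intro HP; apply jump_normal_form in HP; destruct HP as (R & HR & E).
  pose proof (e_K zero_jump) as HK.
  destruct (Sigma2_unique_witness (fun u => forall z, z < p1 u ->
    ~ fin_set (p1 u) z \/ K zero_jump z)) as (W & HW & EW & _); [es|].
  (* [Y ⟨n, m⟩] says that [m], a candidate witness for [P n] paired with evidence for its positive
     oracle claims, fails. *)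
  set (Y := fun x => ~ R (p1 x) (p1 (p2 x)) \/ W ⟨p1 (p1 (p2 x)), p2 (p2 x)⟩ \/
    exists z, z < p2 (p1 (p1 (p2 x))) /\
      (fin_set (p2 (p1 (p1 (p2 x)))) z /\ K zero_jump z)).
  assert (HY : e_le Y zero_jump) by (unfold Y; es).
  assert (EY : forall n, ~ P n <-> forall m, Y ⟨n, m⟩).
  { intro n; rewrite E; unfold Y; split.
    - intros H m; psimp; apply NNPP; intro M; apply H; exists (p1 m).
      split; [apply NNPP; tauto|]; split.
      + apply EW; exists (p2 m); tauto.
      + intros z Lz; destruct (classic (fin_set (p2 (p1 (p1 m))) z)) as [I|I]; [right|auto].
        intro C; apply M; right; right; exists z; auto.
    - intros H (w & Rw & O1 & O2).
      destruct (proj1 (EW (p1 w)) O1) as [a Ha].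
      specialize (H ⟨w, a⟩); psimp.
      destruct H as [H|[H|(z & Lz & I & Kz)]]; [contradiction|contradiction|].
      destruct (O2 z Lz); contradiction. }
  destruct (Sigma2_unique_witness (fun x => forall m, m < S (p2 x) -> Y ⟨p1 x, m⟩))
    as (N & HN & EN & U); [es|].
  exists (fun x => N ⟨⟨p1 x, p1 (p2 x)⟩, p2 (p2 x)⟩); split; [ces|].
  intro n; rewrite EY; split.
  - intros H k; destruct (proj1 (EN ⟨n, k⟩)) as [v Hv]; [intros; psimp; auto|].
    exists ⟨k, v⟩; psimp; split; [apply le_pair_l|exact Hv].
  - intros H m.
    (* Lengths below [m] contribute finitely many pairs by uniqueness, so a large element of the set
       has length at least [m]. *)
    destruct (ball_mono (fun a b => forall v, ~ N ⟨⟨n, a⟩, v⟩ -> ⟨a, v⟩ < b) m) as [b Hb].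
    + intros a b b' L I v Hv; specialize (I v Hv); lia.
    + intros a _; destruct (classic (exists v, ~ N ⟨⟨n, a⟩, v⟩)) as [[v Hv]|M].
      * exists (S ⟨a, v⟩); intros v' Hv'; rewrite (U _ _ _ Hv' Hv); lia.
      * exists 0; intros v Hv; exfalso; eauto.
    + destruct (H b) as (h & Lh & Hh); psimp.
      assert (Lm : m <= p1 h).
      { destruct (le_lt_dec m (p1 h)) as [L|L]; [auto|].
        specialize (Hb _ L _ Hh); rewrite pair_eta in Hb; lia. }
      specialize (EN ⟨n, p1 h⟩); psimp; apply EN; [eauto|lia].
Qed.

Theorem theorem1p3 (A B : Ensemble nat) (hA : Sigma02 A) (hB : Sigma02 B)
  (hAB : Ahmad_pair A B) : high2 B.
Proof.
  pose proof (Ahmad_left_co_e_le A B hA hAB) as HnA.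
  assert (HA : e_le A (jump B)) by (apply e_trans with zero_jump; auto using zero_jump_le_jump).
  destruct (Sigma2_unique_witness (K B)) as (W & HW & HK & U).
  { apply e_trans with B; auto using e_K. }
  destruct (jump_normal_form _ _ (e_certified A B W HW HA HnA)) as (R & HR & ER).
  assert (HJ : e_le (jump zero_jump) (jump (jump B)))
    by apply jump_mono, zero_jump_le_jump.
  (* The positive half is already below [jump zero_jump]; what remains is the complement of
     [K (jump zero_jump)], a Pi-3 set. *)
  apply e_jump_of with (jump zero_jump); [| |apply e_refl].
  { apply e_trans with (jump zero_jump); auto using e_K. }
  destruct (Pi3_infinite _ (e_K (jump zero_jump))) as (N & HN & EN).
  assert (HRC : forall h q w, R ⟨h, q⟩ w -> oracle_ok (K B) (p1 w) -> certified A B W h q).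
  { intros h q w H1 H2; specialize (ER ⟨h, q⟩); psimp; apply ER; eauto. }
  (* At ⟨n, k⟩ this says that a good element occurs at or beyond [k]. It is existential over
     [jump B], so its negation is available from [jump (jump B)]. *)
  assert (Hbad : e_le (fun x => exists h, exists p, p2 x <= h /\
    ~ N ⟨p1 x, h⟩ /\ R ⟨h, p1 p⟩ (p2 p) /\ oracle_ok (K B) (p1 (p2 p)) /\
    (forall g, g < S p -> ~ h < g \/ N ⟨p1 x, g⟩)) (jump B)).
  { assert (HnN : e_le (fun x => ~ N x) (jump B)) by apply e_jump_co_ce, HN.
    pose proof (e_jump_K B); pose proof (e_jump_notK B); unfold oracle_ok; es. }
  apply e_jump_neg in Hbad.
  assert (HnN : e_le (fun x => ~ N x) (jump (jump B))) by apply e_jump_co_ce, HN.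
  eapply e_ext.
  { apply (e_ex _ (fun n k => ~ N ⟨n, k⟩ /\ ~ (exists h, exists p, k <= h /\
    ~ N ⟨n, h⟩ /\ R ⟨h, p1 p⟩ (p2 p) /\ oracle_ok (K B) (p1 (p2 p)) /\
    (forall g, g < S p -> ~ h < g \/ N ⟨n, g⟩)))).
    apply e_and; [es|exact Hbad]. }
  intro n; rewrite EN; split.
  (* If no element of the set followed [h], any certificate for [h] would make it good; so there is
     always a next element. *)
  - intros (k0 & N0 & Hk) k; induction k as [|k IH].
    + exists k0; split; [lia|auto].
    + assert (IH' : exists h, k <= h /\ k0 <= h /\ ~ N ⟨n, h⟩).
      { destruct IH as (h & Lh & Hh); destruct (le_lt_dec k0 h) as [L|L]; [eauto|].
        exists k0; split; [lia|auto]. }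
      destruct IH' as (h & Lh & L0 & Hh).
      destruct (certified_exists A B W h HK U (proj1 hAB)) as [q Hq].
      destruct (proj1 (ER ⟨h, q⟩)) as (w & H1 & H2); [psimp; exact Hq|].
      apply NNPP; intro M; apply Hk; exists h, ⟨q, w⟩; psimp.
      split; [auto|split; [auto|split; [auto|split; [auto|]]]].
      intros g _; destruct (classic (h < g)) as [L|L]; [right|auto].
      apply NNPP; intro C; apply M; exists g; split; [lia|auto].
  - intro Hinf.
    destruct (Ahmad_good_bounded A B (fun h => ~ N ⟨n, h⟩) W R hA hAB HW HK U HR HRC)
      as [k Hk].
    { apply ce_ext with (fun h => N ⟨n, h⟩); [ces|intro; tauto]. }
    destruct (Hinf k) as (k0 & L0 & N0); exists k0; split; [auto|].
    intros (h & p & Lh & Hh & H1 & H2 & H3); apply (Hk h); [lia|].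
    split; [auto|]; exists p; split; [auto|split; [auto|]].
    intros g Lg; destruct (H3 g Lg); [auto|right; tauto].
Qed.
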